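(* Let $q$ be an odd prime power, $n>1$, and let $\ell$ be a nonzero $q$-linear polynomial over $\mathbb F_{q^n}$ of degree less than $q^n$ such that $L=\frac{\ell+\ell'}2$ is nonzero and has all coefficients in $\mathbb F_q$; write $L(x)=\sum_{i=0}^{n-1}a_ix^{q^i}$ and $L^*(x)=\sum_{i=0}^{n-1}a_ix^i\in\mathbb F_q[x]$. Let $\omega_1,\dots,\omega_n$ be elements of an algebraic closure of $\mathbb F_q$ with $x^n-1=\prod_{i=1}^n(x-\omega_i)$, ordered so that $\gcd(L^*(x),x^n-1)=\prod_{i=r+1}^n(x-\omega_i)$ for some $0<r\le n$, and let $G\in\mathbb F_q[x]$ satisfy $L^*(x)\equiv G(x)\prod_{i=r+1}^n(x-\omega_i)\pmod{x^n-1}$. Let $\epsilon$ be the invariant of the quadratic form $\mathrm{Tr}(x\ell(x))$ and $\eta$ the quadratic character of $\mathbb F_q^*$. Then: (1) $\epsilon=1$ if and only if $\prod_{j=1}^rG(\omega_j)^{\frac{q-1}2}=(-1)^{r-1}c^{\frac{q-1}2r+1}$, where $c$ is the constant term of $\gcd(L^*(x),x^n-1)$, which satisfies $c^2=1$; (2) $\epsilon=(-1)^{(n-1-\mu)(\frac{q-1}2r+1)}\eta\big(\prod_{j=1}^rG(\omega_j)\big)$, where $\mu$ is the multiplicity of $-1$ as a root of $\gcd(L^*(x),x^n-1)$; (3) when $r=n$, $\epsilon=(-1)^{n-1}\eta\big(\prod_{j=1}^nL^*(\omega_j)\big)$; (4) when $r=n-2m<n$ and $\ell$ has degree $q^m$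 with leading coefficient $a$, $\epsilon=(-1)^{(n-1)(\frac{q-1}2m+1)}\eta(2a)^n$.
   Context: $\mathrm{Tr}(x)=\sum_{i=0}^{n-1}x^{q^i}$ is the trace of $\mathbb F_{q^n}/\mathbb F_q$. A $q$-linear polynomial has the form $\sum_ia_ix^{q^i}$. For $\ell(x)=\sum_{i=0}^{n-1}b_ix^{q^i}$ define $\ell'(x)=b_0x+\sum_{i=1}^{n-1}(b_ix)^{q^{n-i}}$. The map $x\mapsto\mathrm{Tr}(x\ell(x))$ is a quadratic form on the $\mathbb F_q$-space $\mathbb F_{q^n}$; in suitable $\mathbb F_q$-coordinates it equals $d_1w_1^2+\dots+d_sw_s^2$ with $d_i\in\mathbb F_q^*$, and its invariant is $\epsilon=\eta(d_1\cdots d_s)$, independent of the choice of coordinates. *)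

(* Defs.v *)
From HB Require Import structures.
From mathcomp Require Import all_boot all_order all_algebra all_fingroup.
From mathcomp Require Import all_solvable all_field.

Set Implicit Arguments.
Unset Strict Implicit.
Unset Printing Implicit Defensive.

Import GRing.Theory.
Local Open Scope ring_scope.

(* The quadratic character of F^*, extended by 0 at 0. *)
Definition quad_char (F : finFieldType) (x : F) : int :=
  if x == 0 then 0 else if [exists y : F, x == y ^+ 2] then 1 else - 1.

(* The power sum below lies in 1%VS, the copy of F in E, and its coordinate along 1
   is the corresponding scalar of F (see ftraceE). *)
Definition ftrace (F : finFieldType) (E : fieldExtType F) (x : E) : F :=
  coord [tuple (1 : E)] ord0 (\sum_(i < \dim {:E}) x ^+ (#|F| ^ i)).

Definition qlinear (R : nzRingType) (q : nat) (p : {poly R}) : Prop :=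
  exists (k : nat) (b : 'I_k -> R), p = \sum_(i < k) b i *: 'X^(q ^ i).

(* The companion l' of l; the coefficient b_i of l is l`_(q ^ i). *)
Definition qadjoint (R : nzRingType) (q n : nat) (l : {poly R}) : {poly R} :=
  l`_1 *: 'X + \sum_(1 <= i < n) (l`_(q ^ i) *: 'X) ^+ (q ^ (n - i)).

Definition qsym (R : unitRingType) (q n : nat) (l : {poly R}) : {poly R} :=
  2%:R^-1 *: (l + qadjoint q n l).

(* gcdp is only defined up to a nonzero constant. *)
Definition monic_gcdp (F : fieldType) (p q : {poly F}) : {poly F} :=
  (lead_coef (gcdp p q))^-1 *: gcdp p q.

Definition algebraic_closure (F : fieldType) (K : closedFieldType)
    (iota : {rmorphism F -> K}) : Prop :=
  forall x : K, algebraicOver iota x.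

(* w_i = coord X i are the coordinates with respect to the basis X. *)
Definition qform_invariant (F : finFieldType) (V : vectType F) (Q : V -> F)
    (eps : int) : Prop :=
  exists (X : (\dim {:V}).-tuple V) (s : nat) (d : 'I_(\dim {:V}) -> F),
    [/\ basis_of {:V} X,
        (s <= \dim {:V})%N,
        forall i : 'I_(\dim {:V}), (i < s)%N -> d i != 0,
        forall x, Q x = \sum_(i < \dim {:V} | (i < s)%N) d i * coord X i x ^+ 2
      & eps = quad_char (\prod_(i < \dim {:V} | (i < s)%N) d i)].

Lemma expcardD (F : finFieldType) (E : fieldExtType F) (i : nat) (x y : E) :
  (x + y) ^+ (#|F| ^ i) = x ^+ (#|F| ^ i) + y ^+ (#|F| ^ i).
Proof.
have [p p_pr pF] := finPcharP F.
have pE : p \in [pchar E] by rewrite (fmorph_pchar (in_alg E)).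
have /p_natP[k ->] : p.-nat #|F|.
  by have := pprimeChar_pgroup pF; rewrite /pgroup cardsT.
by apply: exprDn_pchar; rewrite !pnatX (eq_pnat _ (pcharf_eq pE)) pnat_id.
Qed.

Lemma expcardZ (F : finFieldType) (E : fieldExtType F) (i : nat) (c : F)
  (x : E) : (c *: x) ^+ (#|F| ^ i) = c *: x ^+ (#|F| ^ i).
Proof.
rewrite exprZn; congr (_ *: _).
by elim: i => [|i IHi]; rewrite ?expr1 // expnSr exprM IHi expf_card.
Qed.

Lemma ftraceE (F : finFieldType) (E : fieldExtType F) (x : E) :
  (ftrace x)%:A = \sum_(i < \dim {:E}) x ^+ (#|F| ^ i).
Proof.
rewrite /ftrace; set t := \sum_(i < _) _.
have t1 : t \in 1%VS.
  rewrite (Fermat's_little_theorem 1%AS) dimv1 expn1 /t.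
  have q_gt0 : (0 < #|F|)%N by apply/card_gt0P; exists 0.
  have expS (k : nat) (f : nat -> E) :
      (\sum_(i < k) f i) ^+ #|F| = \sum_(i < k) f i ^+ #|F|.
    elim: k => [|k IHk]; first by rewrite !big_ord0 expr0n gtn_eqF.
    by rewrite !big_ord_recr /= -IHk; exact: (@expcardD F E 1).
  apply/eqP; rewrite (expS _ (fun i => x ^+ (#|F| ^ i))).
  under eq_bigr do rewrite -exprM -expnSr.
  have: x ^+ (#|F| ^ \dim {:E}) = x.
    by apply/eqP; rewrite -(Fermat's_little_theorem {:E}%AS) memvf.
  case: (\dim {:E}) => [|d] xd; first by rewrite !big_ord0.
  by rewrite big_ord_recr big_ord_recl /= xd expr1 addrC.
have /coord_span {2}-> : t \in <<[tuple (1%R : E)]>>%VS by rewrite span_seq1.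
by rewrite big_ord1.
Qed.

Lemma ftraceD (F : finFieldType) (E : fieldExtType F) (x y : E) :
  ftrace (x + y) = ftrace x + ftrace y.
Proof.
apply: (fmorph_inj (in_alg E)); rewrite rmorphD /= !ftraceE -big_split /=.
by apply: eq_bigr => i _; rewrite expcardD.
Qed.

Lemma ftraceZ (F : finFieldType) (E : fieldExtType F) (c : F) (x : E) :
  ftrace (c *: x) = c * ftrace x.
Proof.
apply: (fmorph_inj (in_alg E)); rewrite /= -scalerA !ftraceE scaler_sumr.
by apply: eq_bigr => i _; rewrite expcardZ.
Qed.

Lemma qlinear_hornerD (F : finFieldType) (E : fieldExtType F) (l : {poly E}) :
  qlinear #|F| l -> {morph horner l : x y / x + y}.
Proof.
case=> k [b ->] x y; rewrite !horner_sum -big_split /=.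
by apply: eq_bigr => i _; rewrite !hornerE expcardD mulrDr.
Qed.

Lemma qlinear_hornerZ (F : finFieldType) (E : fieldExtType F) (l : {poly E})
    (c : F) (x : E) :
  qlinear #|F| l -> l.[c *: x] = c *: l.[x].
Proof.
case=> k [b ->]; rewrite !horner_sum scaler_sumr /=.
by apply: eq_bigr => i _; rewrite !hornerE expcardZ scalerAr.
Qed.

Lemma orthogonal_basis_exists (F : fieldType) (V : vectType F)
    (B : V -> V -> F) (U : {vspace V}) :
    2%:R != 0 :> F ->
    (forall x y, B x y = B y x) ->
    (forall x, linear_for *%R (B x)) ->
  exists X : seq V, basis_of U X /\
    {in X &, forall x y, x != y -> B x y = 0}.
Proof.
move=> nz2 Bsym Blin.
have BD x y z : B x (y + z) = B x y + B x z.
  by have := Blin x 1 y z; rewrite scale1r mul1r.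
have B0 x : B x 0 = 0.
  by apply/(addrI (B x 0)); rewrite -BD !addr0.
have BZ x c y : B x (c *: y) = c * B x y.
  by have := Blin x c y 0; rewrite !addr0 B0 addr0.
have [m] := ubnP (\dim U); elim: m U => // m IHm U; rewrite ltnS => leUm.
have [/allP B_0 | /allPn[v0 ]] :=
    boolP (all (fun v => all (fun w => B v w == 0) (vbasis U)) (vbasis U)).
  exists (vbasis U); split; first exact: vbasisP.
  by move=> x y /B_0/allP xB /xB/eqP.
move=> Uv0 /allPn[w0 Uw0 nzB].
have {Uv0 Uw0} [v Uv nzv] : exists2 v, v \in U & B v v != 0.
  have [Uv Uw] := (vbasis_mem Uv0, vbasis_mem Uw0).
  have [Bv | ] := eqVneq (B v0 v0) 0; last by exists v0.
  have [Bw | ] := eqVneq (B w0 w0) 0; last by exists w0.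
  exists (v0 + w0); first exact: rpredD.
  rewrite BD !(Bsym (v0 + w0)) !BD Bv Bw add0r addr0 (Bsym w0).
  by rewrite -mulr2n -mulr_natl mulf_neq0.
pose f := (linfun (fun x => B v x : F^o)).
have fE x : f x = B v x.
  pose g x : F^o := B v x.
  have g_lin : linear g by move=> c y z; apply: Blin.
  pose gL := HB.pack_for {linear V -> F^o} g
    (GRing.isLinear.Build _ _ _ _ g g_lin).
  by rewrite /f (lfunE gL).
pose W := (U :&: lker f)%VS.
have vW : v \notin W by rewrite memv_cap memv_ker fE (negPf nzv) andbF.
have dimW : (\dim W < \dim U)%N.
  rewrite ltn_neqAle dimvS ?capvSl // andbT; apply: contra vW => dimWU.
  by rewrite (_ : W = U) //; apply/eqP; rewrite eqEdim capvSl (eqP dimWU) /=.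
have [Y [Ybasis Yorth]] := IHm _ (leq_trans dimW leUm).
have YW y : y \in Y -> B v y = 0.
  by move=> /(basis_mem Ybasis); rewrite memv_cap memv_ker fE => /andP[_ /eqP].
exists (v :: Y); split; last first.
  move=> x y; rewrite !inE => /predU1P[->|Yx] /predU1P[->|Yy].
  - by rewrite eqxx.
  - by rewrite YW.
  - by rewrite Bsym YW.
  - exact: Yorth.
rewrite basisEfree free_cons (span_basis Ybasis) vW (basis_free Ybasis) /=.
have -> /= : (<<v :: Y>> <= U)%VS.
  rewrite span_cons (span_basis Ybasis) subv_add capvSl.
  by rewrite -memvE Uv.
have dimY : size Y = \dim W.
  by rewrite -(span_basis Ybasis); apply/esym/eqP/(basis_free Ybasis).
rewrite dimY -(limg_ker_dim f U) addnC -add1n leq_add2r.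
by rewrite -[X in (_ <= X)%N](dimvf F^o) dimvS ?subvf.
Qed.

Lemma basis_filter (F : fieldType) (V : vectType F) (U : {vspace V})
    (P : pred V) (X : seq V) :
  basis_of U X -> basis_of U (filter P X ++ filter (predC P) X).
Proof.
have eqX : perm_eq (filter P X ++ filter (predC P) X) X.
  by rewrite perm_filterC.
by rewrite !basisEfree (perm_free eqX) (eq_span (perm_mem eqX)) (perm_size eqX).
Qed.

Lemma qform_invariant_exists (F : finFieldType) (V : vectType F)
    (B : V -> V -> F) :
    2%:R != 0 :> F ->
    (forall x y, B x y = B y x) ->
    (forall x, linear_for *%R (B x)) ->
  exists eps : int, qform_invariant (fun x => B x x) eps.
Proof.
move=> nz2 Bsym Blin.
have [X0 [X0b X0o]] := orthogonal_basis_exists {:V} nz2 Bsym Blin.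
pose P := [pred v | B v v != 0].
have := basis_filter P X0b; set X := _ ++ _ => Xb.
have szX : size X == \dim {:V}.
  by rewrite -(span_basis Xb) eq_sym; exact: (basis_free Xb).
pose Xt := Tuple szX; pose s := size (filter P X0).
have s_le : (s <= \dim {:V})%N by rewrite -(eqP szX) size_cat leq_addr.
pose d (i : 'I_(\dim {:V})) := B Xt`_i Xt`_i.
have BD x y z : B x (y + z) = B x y + B x z.
  by have := Blin x 1 y z; rewrite scale1r mul1r.
have B0 x : B x 0 = 0.
  by apply/(addrI (B x 0)); rewrite -BD !addr0.
have BZ x c y : B x (c *: y) = c * B x y.
  by have := Blin x c y 0; rewrite !addr0 B0 addr0.
have Bsum x (f : 'I_(\dim {:V}) -> V) : B x (\sum_i f i) = \sum_i B x (f i).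
  by apply: (big_morph (B x) (BD x) (B0 x)).
exists (quad_char (\prod_(i < \dim {:V} | (i < s)%N) d i)), Xt, s, d.
split=> // [i lt_is | x].
  have : X`_i \in filter P X0 by rewrite nth_cat lt_is mem_nth.
  by rewrite mem_filter => /andP[].
have Xmem (i : 'I_(\dim {:V})) : Xt`_i \in X0.
  have : X`_i \in X by rewrite mem_nth ?(eqP szX).
  by rewrite mem_cat !mem_filter => /orP[] /andP[].
have Xneq (i j : 'I_(\dim {:V})) : i != j -> Xt`_i != Xt`_j.
  by move=> ne; rewrite nth_uniq ?(eqP szX) // (free_uniq (basis_free Xb)).
have {1 2}-> : x = \sum_i coord Xt i x *: Xt`_i.
  by apply: (coord_basis (U := {:V})) (memvf _).
rewrite Bsum [RHS]big_mkcond; apply: eq_bigr => i _.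
rewrite BZ Bsym Bsum (bigD1 i) //= big1 => [|j ne_ji].
  rewrite BZ addr0 mulrA -expr2 mulrC; case: ifP => // ge_si.
  have : X`_i \in filter (predC P) X0.
    rewrite nth_cat ge_si mem_nth // ltn_subLR; last by rewrite leqNgt ge_si.
    by have := ltn_ord i; rewrite -{2}(eqP szX) size_cat.
  by rewrite mem_filter /= negbK => /andP[/eqP-> _]; rewrite mul0r.
by rewrite BZ X0o ?mulr0 ?Xmem // Xneq // eq_sym.
Qed.

Lemma trace_form_invariant_exists (F : finFieldType) (E : fieldExtType F)
    (l : {poly E}) :
    odd #|F| -> qlinear #|F| l ->
  exists eps : int, qform_invariant (fun x => ftrace (x * l.[x])) eps.
Proof.
move=> oddF lin_l.
have nz2 : 2%:R != 0 :> F.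
  have [p p_pr pF] := finPcharP F; apply/negP => F2.
  have : 2%N \in [pchar F] by rewrite inE /= F2.
  rewrite (pcharf_eq pF) !inE => /eqP p2; move: pF; rewrite -p2 => pF.
  have /p_natP[[|k] def_q] : (2%N).-nat #|F|.
    by have := pprimeChar_pgroup pF; rewrite /pgroup cardsT.
  - by have := finNzRing_gt1 F; rewrite def_q.
  - by move: oddF; rewrite def_q oddX.
pose B (x y : E) := 2%:R^-1 * ftrace (x * l.[y] + y * l.[x]).
have [] := @qform_invariant_exists F E B nz2 => [x y|x c y z|eps Beps].
- by rewrite /B addrC.
- rewrite /B qlinear_hornerD // qlinear_hornerZ // mulrDl !mulrDr.
  rewrite -!scalerAl -!scalerAr addrACA -scalerDr.
  by rewrite ftraceD ftraceZ mulrDr mulrCA.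
exists eps; case: Beps => X [s [d [? ? ? QE ?]]]; exists X, s, d; split=> // x.
by rewrite -QE /B -mulr2n -scaler_nat ftraceZ mulKf.
Qed.

(* Main.v *)
Require Import Defs.
From HB Require Import structures.
From mathcomp Require Import all_boot all_order all_algebra all_fingroup.
From mathcomp Require Import all_solvable all_field.

Set Implicit Arguments.
Unset Strict Implicit.
Unset Printing Implicit Defensive.

Import GRing.Theory.
Local Open Scope ring_scope.

(** Let sigma be the q-Frobenius of E and D = gcd(L^*, X^n - 1), X^n - 1 = D H.
    Since Tr(x ell(x)) = Tr(x L^*(sigma)(x)), the form has radical ker D(sigma),
    and if beta generates a normal basis, then beta, ..., sigma^(r-1) beta is a
    basis modulo the radical.  Let C be the matrix of multiplication by X on
    F[X]/(H) and b(X) the sum of the sigma^l(beta) X^l for l < n.  In E the Gram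
    matrix is b(C) Lam b(C)^T, where Lam is the matrix of the form
    (f, g) |-> [X^0] f(X) g(X^-1) L^*(X) on F[X]/(H), and Lam is G(C) times a
    triangular Toeplitz matrix with the constant term c of D on its diagonal.
    Hence the Gram determinant is N^2 c^r prod_j G(omega_j) with N = det b(C),
    and sigma(b(C)) = C^-1 b(C) gives N^(q-1) = det C = (-1)^(r-1) c.  Euler's
    criterion turns this into (1); the other parts follow because D is
    self-reciprocal up to c, so that c is a power of -1 read off from the
    multiplicity of the root -1. *)

(** * Multiplication by X modulo a polynomial *)

Section ModMatrix.

Variables (F : fieldType) (k : nat) (H : {poly F}).
Hypotheses (monH : H \is monic) (szH : size H = k.+2).

(** The companion matrix of [H], acting on row vectors from the right. The degree is written [k.+1]
    so that square matrices form a ring and [horner_mx] applies. *)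
Definition modmx : 'M[F]_k.+1 := \matrix_(i < k.+1) poly_rV ('X^(i.+1) %% H).

Let nzH : H != 0. Proof. exact: monic_neq0. Qed.

Lemma poly_rV_modK (f : {poly F}) : rVpoly (poly_rV (f %% H) : 'rV_k.+1) = f %% H.
Proof. by rewrite poly_rV_K // -ltnS -szH ltn_modp. Qed.

Lemma rVpoly_mul_modmx (v : 'rV_k.+1) : rVpoly (v *m modmx) = (rVpoly v * 'X) %% H.
Proof.
rewrite mulmx_sum_row raddf_sum /= {2}/rVpoly poly_def mulr_suml.
rewrite (big_morph (fun p => p %% H) (fun x y => modpD H x y) (mod0p H)).
apply: eq_bigr => i _; rewrite linearZ /= rowK poly_rV_modK insubT //= => lt_i.
by rewrite -scalerAl -exprSr modpZl; congr (v _ _ *: _); apply: val_inj.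
Qed.

Lemma rVpoly_mul_horner_modmx (v : 'rV_k.+1) (f : {poly F}) :
  rVpoly (v *m horner_mx modmx f) = (rVpoly v * f) %% H.
Proof.
elim/poly_ind: f v => [|f c IHf] v.
  by rewrite rmorph0 mulmx0 mulr0 mod0p linear0.
rewrite rmorphD rmorphM /= horner_mx_X horner_mx_C mulmxDr mulmxA linearD /=.
rewrite rVpoly_mul_modmx IHf mul_mx_scalar linearZ /= mulrDr modpD mulrA.
rewrite [_ %% H * _]mulrC modp_mul [_ * (_ * f)]mulrC -!mulrA; congr (_ + _).
rewrite [_ * c%:P]mulrC mul_polyC modpZl [rVpoly v %% H]modp_small //.
by rewrite szH ltnS size_poly.
Qed.

(** Applied to the row vector of 1, f(C) returns [f] modulo [H]; conversely a multiple of [H] acts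
    as zero on every basis vector. *)
Lemma horner_modmx_eq0 (f : {poly F}) : (horner_mx modmx f == 0) = (H %| f).
Proof.
apply/eqP/idP => [f0 | /modp_eq0P f0].
  have := rVpoly_mul_horner_modmx (poly_rV 1) f.
  rewrite f0 mulmx0 linear0 poly_rV_K ?size_poly1 // mul1r => /esym/eqP.
  by rewrite -/(_ %| _).
apply/row_matrixP => i; rewrite row0 rowE; apply: (can_inj rVpolyK).
by rewrite rVpoly_mul_horner_modmx -modp_mul f0 mulr0 mod0p linear0.
Qed.

(** By Cayley-Hamilton [H] divides the characteristic polynomial, and both are monic of the same
    degree. *)
Lemma char_poly_modmx : char_poly modmx = H.
Proof.
apply/eqP; rewrite eq_sym -eqp_monic ?char_poly_monic //.
rewrite -dvdp_size_eqp ?size_char_poly ?szH //.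
by rewrite -horner_modmx_eq0 Cayley_Hamilton.
Qed.

Lemma det_modmx : \det modmx = (-1) ^+ k.+1 * H`_0.
Proof.
by rewrite -char_poly_modmx char_poly_det mulrA -expr2 sqrr_sign mul1r.
Qed.

End ModMatrix.

(* Both sides are products over the roots z of f of the characteristic
   polynomial at z. *)
Lemma det_horner_mx (K : closedFieldType) (k : nat) (A : 'M[K]_k.+1)
    (w : 'I_k.+1 -> K) (f : {poly K}) :
  char_poly A = \prod_i ('X - (w i)%:P) ->
  \det (horner_mx A f) = \prod_i f.[w i].
Proof.
move=> chA; have [s ->] := closed_field_poly_normal f.
set c := lead_coef f.
rewrite linearZ detZ /=.
rewrite (eq_bigr (fun i => c * (\prod_(z <- s) ('X - z%:P)).[w i])); last first.
  by move=> i _; rewrite hornerZ.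
rewrite big_split /= prodr_const card_ord; congr (_ * _).
elim: s => [|z s IHs].
  by rewrite big_nil rmorph1 det1 big1 // => i _; rewrite hornerE.
rewrite big_cons rmorphM /= det_mulmx IHs.
rewrite [RHS](eq_bigr (fun i => (w i - z) * (\prod_(z <- s) ('X - z%:P)).[w i])); last first.
  by move=> i _; rewrite hornerM hornerXsubC.
rewrite big_split /=; congr (_ * _).
rewrite rmorphB /= horner_mx_X horner_mx_C.
have := congr1 (horner^~ z) chA; rewrite horner_prod => chz.
rewrite (eq_bigr (fun i => (-1) * ('X - (w i)%:P).[z])); last first.
  by move=> i _; rewrite !hornerE mulN1r opprB.
rewrite big_split /= -chz prodr_const card_ord /char_poly -horner_evalE -det_map_mx.
rewrite -detZ; congr (\det _); apply/matrixP => i j.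
by rewrite !mxE /= horner_evalE hornerD hornerN hornerC hornerMn hornerX mulN1r opprB.
Qed.

Lemma det_map_horner_mx (F : fieldType) (K : closedFieldType)
    (iota : {rmorphism F -> K}) (k : nat) (A : 'M[F]_k.+1)
    (w : 'I_k.+1 -> K) (f : {poly F}) :
  map_poly iota (char_poly A) = \prod_i ('X - (w i)%:P) ->
  iota (\det (horner_mx A f)) = \prod_i (map_poly iota f).[w i].
Proof.
by move=> chA; rewrite -det_map_mx map_horner_mx (@det_horner_mx _ _ _ w) // -map_char_poly.
Qed.

(** * The Frobenius module structure and normal elements *)

Section FrobeniusAction.

Import FalgLfun.

Variables (F : finFieldType) (E : fieldExtType F).

Definition frob (x : E) : E := x ^+ #|F|.

Fact frob_linear : linear frob.
Proof.
move=> c x y; have := @expcardD F E 1 (c *: x) y.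
by rewrite expcardZ expn1.
Qed.

HB.instance Definition _ := GRing.isLinear.Build F E E _ frob frob_linear.

Fact frob_monoid : monoid_morphism frob.
Proof. by split=> [|x y]; rewrite /frob ?expr1n ?exprMn. Qed.

HB.instance Definition _ := GRing.isMonoidMorphism.Build E E frob frob_monoid.

Lemma frobX (k : nat) (x : E) : x ^+ (#|F| ^ k) = iter k frob x.
Proof. by elim: k => [|k IHk]; rewrite ?expr1 // expnSr exprM IHk. Qed.

Lemma frob_id (x : E) : iter (\dim {:E}) frob x = x.
Proof.
by rewrite -frobX; apply/eqP; rewrite -(Fermat's_little_theorem {:E}%AS) memvf.
Qed.

(** This makes [E] an F[X]-module in which X acts as the Frobenius. *)
Definition frobp_lfun (f : {poly F}) : 'End(E) := horner_alg (linfun frob) f.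

Definition frobp (f : {poly F}) (x : E) : E := frobp_lfun f x.

Lemma frobpD f g x : frobp (f + g) x = frobp f x + frobp g x.
Proof. by rewrite /frobp /frobp_lfun rmorphD /= lfunE. Qed.

Lemma frobpN f x : frobp (- f) x = - frobp f x.
Proof. by rewrite /frobp /frobp_lfun rmorphN /= lfunE. Qed.

Lemma frobp0p x : frobp 0 x = 0.
Proof. by rewrite /frobp /frobp_lfun rmorph0 lfunE. Qed.

Lemma frobp1p x : frobp 1 x = x.
Proof. by rewrite /frobp /frobp_lfun rmorph1 lfunE. Qed.

Lemma frobpZ c f x : frobp (c *: f) x = c *: frobp f x.
Proof. by rewrite /frobp /frobp_lfun linearZ /= mulr_algl scale_lfunE. Qed.

Lemma frobpM f g x : frobp (f * g) x = frobp f (frobp g x).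
Proof. by rewrite mulrC /frobp /frobp_lfun rmorphM /= lfun_mulE. Qed.

Lemma frobpX x : frobp 'X x = frob x.
Proof. by rewrite /frobp /frobp_lfun horner_algX lfunE. Qed.

Lemma frobpXn k x : frobp 'X^k x = iter k frob x.
Proof.
by elim: k => [|k IHk]; rewrite ?frobp1p // exprS frobpM IHk frobpX.
Qed.

Lemma frobpr0 f : frobp f 0 = 0. Proof. exact: linear0. Qed.

Lemma frobprD f x y : frobp f (x + y) = frobp f x + frobp f y.
Proof. exact: linearD. Qed.

Lemma frobprZ f c x : frobp f (c *: x) = c *: frobp f x.
Proof. exact: linearZ. Qed.

Lemma frobp_sum I (s : seq I) (P : pred I) (g : I -> {poly F}) x :
  frobp (\sum_(i <- s | P i) g i) x = \sum_(i <- s | P i) frobp (g i) x.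
Proof. by apply: (big_morph (frobp^~ x)) => [f h|]; rewrite ?frobpD ?frobp0p. Qed.

Lemma frobpE (f : {poly F}) (k : nat) (x : E) : (size f <= k)%N ->
  frobp f x = \sum_(i < k) f`_i *: iter i frob x.
Proof.
move=> szf; have -> : frobp f x = frobp (\poly_(i < k) f`_i) x.
  congr (frobp _ x); apply/polyP => i; rewrite coef_poly; case: ltnP => // le_ki.
  by rewrite nth_default // (leq_trans szf).
by rewrite poly_def frobp_sum; apply: eq_bigr => i _; rewrite frobpZ frobpXn.
Qed.

Lemma frobp_XnB1 x : frobp ('X^(\dim {:E}) - 1) x = 0.
Proof. by rewrite frobpD frobpN frobpXn frobp1p frob_id subrr. Qed.

Lemma frobp_dvd0 f x : 'X^(\dim {:E}) - 1 %| f -> frobp f x = 0.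
Proof. by case/dvdpP=> g ->; rewrite frobpM frobp_XnB1 frobpr0. Qed.

(* A nonzero f(frob) is a polynomial map of degree at most q^(n-1). *)
Lemma frobp_neq0 (f : {poly F}) : f != 0 -> (size f <= \dim {:E})%N ->
  exists x : E, frobp f x != 0.
Proof.
move=> nzf szf.
pose P : {poly E} := \sum_(i < size f) (f`_i)%:A *: 'X^(#|F| ^ i).
have PE x : P.[x] = frobp f x.
  rewrite (frobpE x (leqnn _)) /P horner_sum; apply: eq_bigr => i _.
  by rewrite !hornerE frobX -scalerAl mul1r.
have q_gt1 : (1 < #|F|)%N := finNzRing_gt1 F.
have [k szk] : exists k, size f = k.+1.
  by move: nzf; rewrite -size_poly_gt0; case: (size f) => // k; exists k.
have coefP : P`_(#|F| ^ k) = (f`_k)%:A.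
  rewrite /P szk coef_sum big_ord_recr /= coefZ coefXn eqxx mulr1.
  rewrite big1 ?add0r // => i _; rewrite coefZ coefXn eqn_exp2l //.
  by rewrite gtn_eqF ?mulr0 // ltn_ord.
have nzP : P != 0.
  apply: contraNneq nzf => P0; move/eqP: coefP; rewrite P0 coef0 eq_sym.
  rewrite scaler_eq0 oner_eq0 orbF => /eqP fk.
  by rewrite -lead_coef_eq0 lead_coefE szk fk.
have szP : (size P <= (#|F| ^ k).+1)%N.
  rewrite /P (leq_trans (size_sum _ _ _)) //; apply/bigmax_leqP => i _.
  rewrite (leq_trans (size_scale_leq _ _)) // size_polyXn ltnS leq_exp2l //.
  by rewrite -ltnS -szk ltn_ord.
pose T := finvect_type E.
have szT : size (enum T) = (#|F| ^ \dim {:E})%N.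
  by rewrite -cardE -(card_vspacef (Vector.on T)) card_vspace.
have [/forallP all0 | ] := boolP [forall x : T, frobp f (x : E) == 0]; last first.
  by rewrite negb_forall => /existsP[x fx]; exists x.
have all_root : all (root P) (enum T).
  by apply/allP => x _; rewrite /root PE; exact: all0.
have := max_poly_roots nzP all_root (enum_uniq T).
rewrite [size _]szT ltnNge => /negP[].
by rewrite (leq_trans szP) // ltn_exp2l // -szk.
Qed.

Lemma frobp_coprime0 f g x : coprimep f g -> frobp f x = 0 -> frobp g x = 0 -> x = 0.
Proof.
move=> /Bezout_eq1_coprimepP[[u v] /= uv] fx gx.
by rewrite -[x]frobp1p -uv frobpD !frobpM fx gx !frobpr0 addr0.
Qed.

Lemma irreducible_coprimep (p f : {poly F}) :
  irreducible_poly p -> ~~ (p %| f) -> coprimep p f.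
Proof.
move=> irrp pNf; rewrite /coprimep size_poly_eq1.
have [|/eqp_dvdl gcdE] := irredp_XsubCP irrp (dvdp_gcdl p f) => //.
by rewrite -gcdE dvdp_gcdr in pNf.
Qed.

Lemma irreducible_factor (d : {poly F}) : (1 < size d)%N ->
  exists p, irreducible_poly p /\ p %| d.
Proof.
have [k] := ubnP (size d); elim: k d => // k IHk d; rewrite ltnS => szd d1.
(* Over a finite field, polynomials of bounded size are finitely many padded tuples, so the
   existence of a proper nonconstant divisor is a boolean condition. *)
have [irr|] := boolP [exists p : (size d).-tuple F,
    (1 < size (Poly p))%N && (size (Poly p) < size d)%N && (Poly p %| d)].
  have /existsP[p /andP[/andP[p1 pd] pdvd]] := irr.
  have [g [irrg gp]] := IHk _ (leq_trans pd szd) p1.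
  by exists g; split=> //; apply: dvdp_trans pdvd.
rewrite negb_exists => /forallP noP; exists d; split=> //; split=> // p p1 pd.
have nzd : d != 0 by rewrite -size_poly_gt0 ltnW.
have nzp : p != 0 by apply: dvdpN0 pd nzd.
rewrite -dvdp_size_eqp // eqn_leq dvdp_leq //= leqNgt; apply/negP => szp.
have szt : size (p ++ nseq (size d - size p) 0) == size d.
  by rewrite size_cat size_nseq subnKC // ltnW.
have pE : Poly (Tuple szt) = p.
  by apply/polyP => i; rewrite coef_Poly /= nth_cat nth_nseq !if_same;
     case: ltnP => // szi; rewrite nth_default.
have := noP (Tuple szt); rewrite pE szp pd !andbT -leqNgt leq_eqVlt (negPf p1) ltnS.
by rewrite leqn0 size_poly_eq0 (negPf nzp).
Qed.

Lemma primary_split (d p : {poly F}) : d != 0 -> irreducible_poly p -> p %| d ->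
  exists e d', d = p ^+ e.+1 * d' /\ coprimep p d'.
Proof.
move=> nzd irrp; have [p1 _] := irrp.
have [k] := ubnP (size d); elim: k d nzd => // k IHk d nzd; rewrite ltnS => szd.
case/dvdpP=> g dE; have nzp : p != 0 by rewrite -size_poly_gt0 ltnW.
have nzg : g != 0 by apply: contraNneq nzd => g0; rewrite dE g0 mul0r.
have [pg|] := boolP (p %| g).
  have [|e [d' [gE cop]]] := IHk g nzg _ pg.
    apply: leq_trans szd; rewrite dE size_mul //.
    by case: (size p) p1 => [|[|s]] // _; rewrite !addnS /= ltnS leq_addr.
  by exists e.+1, d'; split=> //; rewrite dE gE mulrC mulrA -exprS.
move/(irreducible_coprimep irrp) => cop.
by exists 0%N, g; split=> //; rewrite expr1 mulrC.
Qed.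

(** The vector is built prime by prime: two vectors with coprime annihilators add up to one whose
    annihilator is their product. *)
Lemma frobp_annihilator d : d %| 'X^(\dim {:E}) - 1 ->
  exists v : E, forall f, frobp f v = 0 <-> d %| f.
Proof.
set n := \dim _; have nzXn : 'X^n - 1 != 0 :> {poly F}.
  by rewrite monic_neq0 // monicXnsubC // adim_gt0.
have szXn : size ('X^n - 1 : {poly F}) = n.+1 by rewrite size_XnsubC // adim_gt0.
have [k] := ubnP (size d); elim: k d => // k IHk d; rewrite ltnS => szd dn.
have nzd : d != 0 by apply: dvdpN0 dn nzXn.
have [d1|d1] := leqP (size d) 1.
  exists 0 => f; rewrite frobpr0; split=> // _.
  by apply: (dvdp_trans _ (dvd1p f)); rewrite dvdp1 eqn_leq d1 size_poly_gt0.
have [p [irrp pd]] := irreducible_factor d1; have [p1 _] := irrp.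
have [e [d' [dE cop]]] := primary_split nzd irrp pd.
have nzp : p != 0 by rewrite -size_poly_gt0 ltnW.
have nzd' : d' != 0 by apply: contraNneq nzd => g0; rewrite dE g0 mulr0.
have copX j : coprimep (p ^+ j) d' by rewrite coprimep_expl.
have d'd : d' %| d by rewrite dE dvdp_mull.
have [|v vP] := IHk d' _ (dvdp_trans d'd dn).
  apply: leq_trans szd; rewrite dE exprS -mulrA size_mul ?mulf_neq0 ?expf_neq0 //.
  have: (size d' <= size (p ^+ e * d')%R)%N.
    by apply: dvdp_leq; rewrite ?mulf_neq0 ?expf_neq0 ?dvdp_mull.
  by case: (size p) p1 => [|[|s]] // _ le; rewrite !addSn /= ltnS (leq_trans le) ?leq_addl.
have [g gE] := dvdpP _ _ dn.
(* Write X^n - 1 = [p * w]. As [w] has size at most n, some [x] is not killed by w(sigma); its image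
   under [d' * g] is killed by [p ^+ e.+1] but not by [p ^+ e]. *)
have [u u1 u2] : exists2 u, frobp (p ^+ e.+1) u = 0 & frobp (p ^+ e) u != 0.
  pose w := p ^+ e * d' * g.
  have wE : 'X^n - 1 = p * w by rewrite gE dE /w exprS -!mulrA mulrC -!mulrA.
  have nzw : w != 0 by apply: contraNneq nzXn => w0; rewrite wE w0 mulr0.
  have szw : (size w <= n)%N.
    move: szXn; rewrite wE size_mul //; case: (size p) p1 => [|[|s]] // _.
    by rewrite !addSn /= => -[<-]; rewrite leq_addl.
  have [x wx] := frobp_neq0 nzw szw; exists (frobp (d' * g) x).
    by rewrite -frobpM mulrA -dE mulrC -gE frobp_XnB1.
  by rewrite -frobpM mulrA.
(* Since [p ^+ e.+1] kills [u], the annihilator of [u] is generated by a power of [p], and [u2]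
   excludes exponents below [e.+1]. *)
have uP f : frobp f u = 0 -> p ^+ e.+1 %| f.
  move=> fu; have [->|nzf] := eqVneq f 0; first exact: dvdp0.
  have [pf|pNf] := boolP (p %| f); last first.
    case/eqP: u2; rewrite (frobp_coprime0 (f := p ^+ e.+1) (g := f) (x := u)) ?frobpr0 //.
    by rewrite coprimep_expl // irreducible_coprimep.
  have [j [f' [fE cop']]] := primary_split nzf irrp pf.
  have [le_ej|lt_je] := leqP e.+1 j.+1.
    by rewrite fE dvdp_mulr // dvdp_exp2l.
  case/eqP: u2.
  have ju : frobp (p ^+ j.+1) u = 0.
    apply: (frobp_coprime0 (f := p ^+ e.+1) (g := f')).
    - by rewrite coprimep_expl.
    - by rewrite -frobpM mulrC frobpM u1 frobpr0.
    - by rewrite -frobpM mulrC -fE.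
  by rewrite -(subnK (lt_je : (j.+1 <= e)%N)) exprD frobpM ju frobpr0.
(* Multiplying by [d'] removes the component [v], which gives divisibility by [p ^+ e.+1]; then the
   component [u] vanishes and [v] gives divisibility by [d']. *)
exists (u + v) => f; split=> [fuv | ].
  have pf : p ^+ e.+1 %| f.
    rewrite -(Gauss_dvdpl _ (copX _)); apply: uP.
    have fv : frobp (d' * f) v = 0 by apply/vP; rewrite dvdp_mulr.
    have := congr1 (frobp d') fuv; rewrite frobpr0 -frobpM frobprD fv addr0.
    by rewrite mulrC.
  rewrite dE Gauss_dvdp // pf /=; apply/vP.
  move: fuv; rewrite frobprD => /eqP; rewrite [X in X + _](_ : _ = 0) ?add0r => [/eqP //|].
  by have /dvdpP[t ->] := pf; rewrite frobpM u1 frobpr0.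
rewrite dE => df; rewrite frobprD.
have -> : frobp f v = 0 by apply/vP; apply: dvdp_trans df; rewrite dvdp_mull.
have /dvdpP[t ->] : p ^+ e.+1 %| f by apply: dvdp_trans df; rewrite dvdp_mulr.
by rewrite frobpM u1 frobpr0 addr0.
Qed.

(** The normal basis theorem: no nonzero polynomial of degree below n in the Frobenius kills [v], so
    its n conjugates are independent. *)
Lemma normal_element :
  exists v : E, forall f, frobp f v = 0 <-> 'X^(\dim {:E}) - 1 %| f.
Proof. exact: frobp_annihilator. Qed.

End FrobeniusAction.

(** * Quadratic forms over finite fields *)

Section QuadraticCharacter.

Variable F : finFieldType.
Hypothesis oddF : odd #|F|.

Lemma natr2_neq0 : 2%:R != 0 :> F.
Proof.
have [p p_pr pF] := finPcharP F; apply/negP => F2.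
have : 2%N \in [pchar F] by rewrite inE /= F2.
rewrite (pcharf_eq pF) !inE => /eqP p2; move: pF; rewrite -p2 => pF.
have /p_natP[[|k] def_q] : (2%N).-nat #|F|.
  by have := pprimeChar_pgroup pF; rewrite /pgroup cardsT.
- by have := finNzRing_gt1 F; rewrite def_q.
- by move: oddF; rewrite def_q oddX.
Qed.

Lemma card_half : (#|F|.-1 = 2 * ((#|F| - 1) %/ 2))%N.
Proof.
rewrite subn1 mulnC divnK // dvdn2; have := finNzRing_gt1 F.
by case: #|F| oddF => //= k; rewrite negbK => /negPf->.
Qed.

Lemma expf_pred_card (x : F) : x != 0 -> x ^+ #|F|.-1 = 1.
Proof.
move=> nzx; apply: (mulfI nzx); rewrite mulr1 -exprS prednK ?expf_card //.
by rewrite ltnW // finNzRing_gt1.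
Qed.

Lemma euler_criterion (x : F) :
  x != 0 -> x ^+ ((#|F| - 1) %/ 2) = (quad_char x)%:~R.
Proof.
move=> nzx; rewrite /quad_char (negPf nzx); case: ifPn => [/existsP[y /eqP xE]|].
  rewrite xE -exprM -card_half expf_pred_card //.
  by apply: contraNneq nzx => y0; rewrite xE y0 expr0n.
set h := (_ %/ _)%N => notsq.
have x2h : (x ^+ h) ^+ 2 = 1 by rewrite -exprM mulnC -card_half expf_pred_card.
have [xh | xh] : x ^+ h = 1 \/ x ^+ h = -1.
  by move/eqP: x2h; rewrite sqrf_eq1 => /orP[]/eqP; [left|right].
  (* With [g] a generator of F^* and x = g^k, the equation x^h = 1 forces 2h to divide kh, so k is
     even and x would be a square. *)
  have /cyclicP[g gE] := field_unit_group_cyclic [set: {unit F}]%G.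
  have /cycleP[k kE] : finField_unit nzx \in <[g]>%g.
    by rewrite -gE inE.
  case/negP: notsq.
  have ord_g : #[g]%g = (2 * h)%N by rewrite orderE -gE card_finField_unit card_half.
  have : (g ^+ (k * h) == 1)%g.
    by rewrite expgM -kE; apply/eqP/val_inj; rewrite FinRing.val_unitX /= xh.
  rewrite -order_dvdn ord_g.
  have h_gt0 : (0 < h)%N.
    have := finNzRing_gt1 F; rewrite lt0n /h; case: eqP => // h0.
    by rewrite ltnNge; have := card_half; rewrite h0; case: #|F| => [|[]].
  rewrite dvdn_pmul2r // => /dvdnP[j jE]; apply/existsP; exists (val g ^+ j).
  rewrite -exprM -jE -FinRing.val_unitX -kE //.
by rewrite xh.
Qed.

Lemma quad_char_neq0 (x : F) : x != 0 -> quad_char x = 1 \/ quad_char x = -1.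
Proof.
by rewrite /quad_char => /negPf->; case: ifP; [left|right].
Qed.

(** Signs are compared after casting to F, where 1 and -1 stay distinct because q is odd. *)
Lemma signz_inj (u v : int) : u = 1 \/ u = -1 -> v = 1 \/ v = -1 ->
  u%:~R = v%:~R :> F -> u = v.
Proof.
have neq : 1 != -1 :> F.
  by rewrite -subr_eq0 opprK -[1 + 1]/(2%:R) natr2_neq0.
by case=> -> [] -> // /eqP; [rewrite (negPf neq)|rewrite eq_sym (negPf neq)].
Qed.

Lemma quad_charMsq (u x : F) : u != 0 -> quad_char (u ^+ 2 * x) = quad_char x.
Proof.
move=> nzu; have [->|nzx] := eqVneq x 0; first by rewrite mulr0.
have nzux : u ^+ 2 * x != 0 by rewrite mulf_neq0 ?expf_neq0.
apply: signz_inj; try exact: quad_char_neq0.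
by rewrite -!euler_criterion // exprMn -exprM -card_half expf_pred_card ?mul1r.
Qed.

End QuadraticCharacter.

(** * The invariant as the quadratic character of a Gram determinant *)

Section GramInvariant.

Variables (F : finFieldType) (V : vectType F) (Q : V -> F) (B : V -> V -> F).
Hypotheses (oddF : odd #|F|) (Bsym : forall x y, B x y = B y x).
Hypotheses (Blin : forall x, linear_for *%R (B x)) (QE : forall x, Q x = B x x).

Let BD x y z : B x (y + z) = B x y + B x z.
Proof. by have := Blin x 1 y z; rewrite scale1r mul1r. Qed.

Let B0 x : B x 0 = 0.
Proof. by apply/(addrI (B x 0)); rewrite -BD !addr0. Qed.

Let BZ x c y : B x (c *: y) = c * B x y.
Proof. by have := Blin x c y 0; rewrite !addr0 B0 addr0. Qed.

Let Bsum x k (f : 'I_k -> V) : B x (\sum_i f i) = \sum_i B x (f i).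
Proof. exact: (big_morph (B x) (BD x) (B0 x)). Qed.

Lemma polarization x y : B x y *+ 2 = Q (x + y) - Q x - Q y.
Proof.
rewrite !QE BD !(Bsym (x + y)) !BD (Bsym y x) mulr2n.
by rewrite addrA [RHS]addrAC addrK [RHS]addrC addrA addKr.
Qed.

(** The family [Y] spans modulo the radical. Writing the Gram matrix in the diagonal coordinates,
    and the diagonal matrix in terms of [Y], gives [s = k] by comparing ranks; the two determinants
    then differ by the square of the determinant of [P]. *)
Lemma qform_invariant_gram (k : nat) (Y : 'I_k -> V) (eps : int) :
    (forall x, exists c : 'I_k -> F, forall y, B y x = B y (\sum_i c i *: Y i)) ->
    \det (\matrix_(i, j) B (Y i) (Y j)) != 0 ->
    qform_invariant Q eps ->
  eps = quad_char (\det (\matrix_(i, j) B (Y i) (Y j))).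
Proof.
set M := \matrix_(i, j) _ => Yspan nzM [X [s [d [Xb les nzd QX epsE]]]].
have nz2 := natr2_neq0 oddF.
have BX x y : B x y = \sum_(i < \dim {:V} | (i < s)%N) d i * (coord X i x * coord X i y).
  apply: (mulfI nz2); rewrite mulr_natl polarization !QX -!sumrB mulr_sumr.
  apply: eq_bigr => i _; rewrite linearD /= sqrrD -!mulrBr mulrCA; congr (_ * _).
  by rewrite [LHS]addrAC addrK addrAC subrr add0r mulr_natl.
pose w := widen_ord les; pose dd := \row_(i < s) d (w i).
pose P := \matrix_(i < k, j < s) coord X (w j) (Y i).
have ME : M = P *m diag_mx dd *m P^T.
  apply/matrixP => i j; rewrite !mxE BX (big_ord_narrow les); apply: eq_bigr => l _.
  by rewrite mul_mx_diag !mxE mulrCA mulrA.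
have uM : M \in unitmx by rewrite unitmxE unitfE.
have le_ks : (k <= s)%N.
  have : \rank M = k by apply/eqP; move: uM; rewrite -row_free_unit.
  by rewrite ME => {1}<-; apply: leq_trans (mulmx_max_rank _ _) _.
have [C CE] : exists C : 'M[F]_(s, k), diag_mx dd = C *m M *m C^T.
  have /fin_all_exists[C CP] : forall i : 'I_s, exists c : 'rV_k,
      forall y, B y X`_i = B y (\sum_j c 0 j *: Y j).
    move=> i; have [c cP] := Yspan X`_i; exists (\row_j c j) => y.
    by rewrite cP; congr (B y _); apply: eq_bigr => j _; rewrite mxE.
  exists (\matrix_i C i); apply/matrixP => i j.
  have Bij : B X`_i X`_j = diag_mx dd i j.
    have cX (u v : 'I_s) : coord X (w u) X`_v = (v == u)%:R.
      exact: (coord_free (w v) (w u) (basis_free Xb)).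
    rewrite BX (big_ord_narrow les) (bigD1 i) //= big1 ?addr0; last first.
      by move=> l lni; rewrite cX eq_sym (negPf lni) mul0r mulr0.
    by rewrite !cX eqxx mul1r !mxE eq_sym; case: eqP => _; rewrite ?mulr1 ?mulr0.
  rewrite -Bij CP Bsum mxE; apply: eq_bigr => l _.
  rewrite BZ Bsym CP Bsum mulrC !mxE; congr (_ * _).
  by apply: eq_bigr => t _; rewrite BZ !mxE Bsym.
have le_sk : (s <= k)%N.
  have ud : diag_mx dd \in unitmx.
    rewrite unitmxE unitfE det_diag; apply/prodf_neq0 => i _; rewrite mxE.
    exact: (nzd (w i) (ltn_ord i)).
  have : \rank (diag_mx dd) = s by apply/eqP; move: ud; rewrite -row_free_unit.
  rewrite CE => {1}<-; apply: leq_trans (mulmx_max_rank _ _) _.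
  exact: leqnn.
have es : s = k by apply/eqP; rewrite eqn_leq le_sk.
(* The dimension [s'] is kept general so that [s' = k] can be substituted; only then is [P'] a
   square matrix with a determinant. *)
have det_eq (s' : nat) (P' : 'M[F]_(k, s')) (d' : 'rV_s') : s' = k ->
    M = P' *m diag_mx d' *m P'^T -> quad_char (\det (diag_mx d')) = quad_char (\det M).
  move=> es'; subst s' => ME'; move: nzM; rewrite ME' !det_mulmx det_tr.
  rewrite !mulf_eq0 !negb_or => /andP[/andP[nzP _] _].
  by rewrite mulrAC -expr2 quad_charMsq.
rewrite epsE (big_ord_narrow les) -(det_eq _ _ _ es ME) det_diag.
by congr (quad_char _); apply: eq_bigr => i _; rewrite mxE.
Qed.

End GramInvariant.

(** * Symmetric forms on F[X]/(X^n - 1) *)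

Section CyclicAlgebra.

Variables (F : fieldType) (n : nat).
Hypothesis n_gt1 : (1 < n)%N.

Let n_gt0 : (0 < n)%N. Proof. exact: ltnW. Qed.

Local Notation Xn := ('X^n - 1 : {poly F}).

(* The constant coefficient in F[X]/(X^n - 1). *)
Definition cyc0 (p : {poly F}) : F := (p %% Xn)`_0.

(* The involution induced by X |-> X^-1 on F[X]/(X^n - 1). *)
Definition cycbar (p : {poly F}) : {poly F} := p \Po 'X^(n.-1).

Lemma cyc0D p q : cyc0 (p + q) = cyc0 p + cyc0 q.
Proof. by rewrite /cyc0 modpD coefD. Qed.

Lemma cyc0Z c p : cyc0 (c *: p) = c * cyc0 p.
Proof. by rewrite /cyc0 modpZl coefZ. Qed.

Lemma cyc0_0 : cyc0 0 = 0.
Proof. by rewrite /cyc0 mod0p coef0. Qed.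

Lemma cyc0_sum I (s : seq I) (P : pred I) (f : I -> {poly F}) :
  cyc0 (\sum_(i <- s | P i) f i) = \sum_(i <- s | P i) cyc0 (f i).
Proof. exact: (big_morph cyc0 cyc0D cyc0_0). Qed.

Lemma cyc0_dvd p : Xn %| p -> cyc0 p = 0.
Proof. by rewrite /cyc0 => /modp_eq0 ->; rewrite coef0. Qed.

Lemma cyc0_eq p q : Xn %| p - q -> cyc0 p = cyc0 q.
Proof. by move=> pq; rewrite -(subrK q p) cyc0D cyc0_dvd ?add0r. Qed.

Lemma dvd_XnM_sub1 m : Xn %| 'X^(n * m) - 1.
Proof. by rewrite exprM -{2}[1](expr1n _ m) subrXX dvdp_mulr. Qed.

Lemma cyc_eqXn m1 m2 : m1 = m2 %[mod n] -> Xn %| 'X^m1 - 'X^m2.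
Proof.
wlog le12 : m1 m2 / (m2 <= m1)%N => [hw eq12 | eq12].
  have [/hw|/ltnW/hw] := leqP m2 m1; first exact.
  by rewrite -(opprB 'X^m2 'X^m1) dvdpNr; apply; rewrite eq12.
have /dvdnP[k kE] : (n %| m1 - m2)%N by rewrite -eqn_mod_dvd // eq12.
rewrite -(subnK le12) exprD -{2}['X^m2]mul1r -mulrBl dvdp_mulr //.
by rewrite kE mulnC dvd_XnM_sub1.
Qed.

Lemma cyc0_small (p : {poly F}) : (size p <= n)%N -> cyc0 p = p`_0.
Proof. by move=> szp; rewrite /cyc0 modp_small // size_XnsubC. Qed.

Lemma cyc0Xn m : cyc0 'X^m = (n %| m)%:R.
Proof.
rewrite (@cyc0_eq _ 'X^(m %% n)) ?cyc_eqXn ?modn_mod //.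
by rewrite cyc0_small ?coefXn 1?eq_sym // size_polyXn ltn_mod.
Qed.

Lemma dvdn_mul_pred m : (n %| n.-1 * m)%N = (n %| m)%N.
Proof. by rewrite Gauss_dvdr // coprimenP. Qed.

Lemma cyc0_bar p : cyc0 (cycbar p) = cyc0 p.
Proof.
rewrite /cycbar comp_polyE -[in RHS](coefK p) poly_def !cyc0_sum.
by apply: eq_bigr => i _; rewrite !cyc0Z -exprM !cyc0Xn dvdn_mul_pred.
Qed.

Lemma cycbarM p q : cycbar (p * q) = cycbar p * cycbar q.
Proof. exact: rmorphM. Qed.

Lemma cycbarXn m : cycbar 'X^m = 'X^(n.-1 * m).
Proof. by rewrite /cycbar comp_Xn_poly exprM. Qed.

(** The exponent (n-1)^2 is congruent to 1 modulo n. *)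
Lemma cycbarK p : Xn %| cycbar (cycbar p) - p.
Proof.
elim/poly_ind: p => [|p c IHp]; first by rewrite /cycbar !rmorph0 subrr dvdp0.
have -> : cycbar (cycbar (p * 'X + c%:P)) - (p * 'X + c%:P)
    = (cycbar (cycbar p) - p) * 'X^(n.-1 * n.-1) + p * ('X^(n.-1 * n.-1) - 'X^1).
  rewrite /cycbar !rmorphD !rmorphM /= !comp_polyC comp_polyX comp_Xn_poly -exprM.
  by rewrite mulrBl mulrBr addrA subrK opprD addrACA subrr addr0.
apply: dvdp_add; [exact: dvdp_mulr | apply/dvdp_mull/cyc_eqXn].
case: n n_gt1 => [|[|m]] // _ /=.
by rewrite mulSn addSn -mulnS -addn1 modnMDl.
Qed.

(** * The cyclic form attached to a symmetric [L], and its determinant *)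

Section CyclicForm.

Variables (L H D G : {poly F}) (k : nat).
Hypotheses (symL : Xn %| cycbar L - L) (DH : D * H = Xn) (DL : D %| L).
Hypotheses (monH : H \is monic) (szH : size H = k.+2).

Definition cycform (f h : {poly F}) := cyc0 (f * cycbar h * L).

Lemma cycformDl f g h : cycform (f + g) h = cycform f h + cycform g h.
Proof. by rewrite /cycform !mulrDl cyc0D. Qed.

Lemma cycformZl c f h : cycform (c *: f) h = c * cycform f h.
Proof. by rewrite /cycform -!scalerAl cyc0Z. Qed.

(** The involution preserves the constant coefficient, exchanges the two arguments and fixes [L]
    modulo X^n - 1. *)
Lemma cycformC f h : cycform f h = cycform h f.
Proof.
rewrite /cycform -cyc0_bar !cycbarM; apply: cyc0_eq.
rewrite [X in _ %| X](_ : _ = cycbar f * (cycbar (cycbar h) - h) * cycbar L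
                     + cycbar f * h * (cycbar L - L)).
  apply: dvdp_add; last exact: dvdp_mull.
  by rewrite mulrAC; apply/dvdp_mull/cycbarK.
by rewrite !mulrBr !mulrBl addrA subrK [h * _]mulrC.
Qed.

(** Since [D] divides [L], a multiple of [H] times [L] is divisible by [D * H], that is, by X^n - 1;
    so the form descends to F[X]/(H). *)
Lemma cycform_modl f h : cycform (f %% H) h = cycform f h.
Proof.
rewrite [in RHS](divp_eq f H) cycformDl [X in _ = X + _](_ : _ = 0) ?add0r //.
rewrite /cycform cyc0_dvd //; have [g ->] := dvdpP _ _ DL.
by rewrite -!mulrA [H * _]mulrCA [H * _]mulrCA [H * D]mulrC DH !dvdp_mull.
Qed.

Lemma cycform_modr f h : cycform h (f %% H) = cycform h f.
Proof. by rewrite !(cycformC h) cycform_modl. Qed.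

Lemma cycformXn i j : cycform 'X^i 'X^j = cyc0 ('X^(i + n.-1 * j) * L).
Proof. by rewrite /cycform cycbarXn -exprD. Qed.

Definition cycform_mx : 'M[F]_k.+1 := \matrix_(i, j) cycform 'X^i 'X^j.

Lemma cycform_mxE (u v : 'rV_k.+1) :
  (u *m cycform_mx *m v^T) 0 0 = cycform (rVpoly u) (rVpoly v).
Proof.
have rVE (w : 'rV[F]_k.+1) : rVpoly w = \sum_(i < k.+1) w 0 i *: 'X^i.
  rewrite /rVpoly poly_def; apply: eq_bigr => i _; rewrite insubT //= => lt_i.
  by congr (w _ _ *: _); apply: val_inj.
have formsl I (s : seq I) (f : I -> {poly F}) h :
    cycform (\sum_(i <- s) f i) h = \sum_(i <- s) cycform (f i) h.
  apply: (big_morph (cycform^~ h) (fun f g => cycformDl f g h)).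
  by rewrite /cycform !mul0r cyc0_0.
rewrite !rVE formsl -mulmxA mxE; apply: eq_bigr => i _; rewrite cycformZl.
rewrite cycformC formsl mxE; congr (_ * _); apply: eq_bigr => j _.
by rewrite cycformZl cycformC !mxE mulrC.
Qed.

Local Notation C := (modmx k H).

(** Row i of C^a is X^(i+a) modulo [H], and the form sees only residues modulo [H]. *)
Lemma modmxX_cycform a b :
  C ^+ a *m cycform_mx *m (C ^+ b)^T
    = \matrix_(i, j) cyc0 ('X^(i + a + n.-1 * (j + b)) * L).
Proof.
have CE t (i : 'I_k.+1) : rVpoly (delta_mx 0 i *m C ^+ t : 'rV_k.+1) = 'X^(i + t) %% H.
  have -> : C ^+ t = horner_mx C 'X^t by rewrite rmorphXn /= horner_mx_X.
  by rewrite rVpoly_mul_horner_modmx // rVpoly_delta -exprD.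
apply/matrixP => i j; rewrite [RHS]mxE -cycformXn -cycform_modl -cycform_modr.
rewrite -!CE -cycform_mxE -!rowE -row_mul [LHS]mxE [RHS]mxE.
by apply: eq_bigr => l _; rewrite !mxE.
Qed.

Hypothesis GL : Xn %| L - G * D.

(** As [L] is [G * D] modulo X^n - 1, the matrix is G(C) times the Toeplitz matrix [T] of [D], which
    is upper triangular with the constant term of [D] on its diagonal. *)
Lemma det_cycform_mx : \det cycform_mx = \det (horner_mx C G) * D`_0 ^+ k.+1.
Proof.
have nzH := monic_neq0 monH.
pose T := \matrix_(i < k.+1, j < k.+1) cyc0 ('X^(i + n.-1 * j) * D).
have Tmod f j : cyc0 (f %% H * 'X^(n.-1 * j) * D) = cyc0 (f * 'X^(n.-1 * j) * D).
  apply: cyc0_eq; rewrite -!mulrBl; have -> : f %% H - f = - (f %/ H) * H.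
    by rewrite [X in _ - X](divp_eq f H) opprD addrCA subrr addr0 mulNr.
  by rewrite -!mulrA [H * _]mulrCA [H * D]mulrC DH !dvdp_mull.
have -> : cycform_mx = horner_mx C G *m T.
  apply/matrixP => i j; rewrite mxE /cycform cycbarXn.
  rewrite (@cyc0_eq _ ('X^i * G * 'X^(n.-1 * j) * D)); last first.
    rewrite [X in _ %| X](_ : _ = 'X^i * 'X^(n.-1 * j) * (L - G * D)) ?dvdp_mull //.
    by rewrite mulrBr [_ * (G * D)]mulrA ['X^i * _ * G]mulrAC.
  rewrite -Tmod.
  rewrite -(rVpoly_delta _ i) -(rVpoly_mul_horner_modmx monH szH) -rowE /rVpoly.
  rewrite poly_def !mulr_suml cyc0_sum mxE; apply: eq_bigr => l _.
  rewrite insubT //= => lt_l; rewrite -!scalerAl cyc0Z !mxE exprD.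
  by congr (horner_mx _ _ _ _ * _); apply: val_inj.
rewrite det_mulmx -(det_tr T); congr (_ * _).
have szD : (size D + k.+1 = n.+1)%N.
  have nzD : D != 0.
    apply/eqP => D0; have := size_XnsubC (1 : F) n_gt0.
    by rewrite -DH D0 mul0r size_poly0.
  by have := size_XnsubC (1 : F) n_gt0; rewrite -DH size_mul // szH addnS.
(* For j <= i the product X^(i-j) D has degree at most k + (n-k-1) < n, so nothing wraps around
   modulo X^n - 1. *)
have TE (i j : 'I_k.+1) : (j <= i)%N -> T i j = D`_0 *+ (i == j).
  move=> le_ji; rewrite mxE (@cyc0_eq _ ('X^(i - j) * D)).
    rewrite cyc0_small; last first.
      rewrite (leq_trans (size_polyMleq _ _)) // size_polyXn.
      rewrite addSn /= -ltnS -szD addnC ltn_add2l ltnS.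
      by rewrite (leq_trans (leq_subr _ _)) // -ltnS.
    by rewrite coefXnM lt0n subn_eq0 -val_eqE /= eqn_leq le_ji andbT; case: leqP.
  rewrite -mulrBl dvdp_mulr // cyc_eqXn // -{1}(subnK le_ji) -addnA.
  by rewrite -mulSn prednK // mulnC addnC modnMDl.
rewrite det_trig; last first.
  by apply/is_trig_mxP => i j lt_ij; rewrite mxE TE 1?ltnW // -val_eqE /= gtn_eqF.
rewrite (eq_bigr (fun=> D`_0)) ?prodr_const ?card_ord // => i _.
by rewrite mxE TE // eqxx.
Qed.

End CyclicForm.

End CyclicAlgebra.

(** * Trace forms *)

Section TraceForm.

Variables (F : finFieldType) (E : fieldExtType F).

Local Notation n := (\dim {:E}).
Local Notation sigma := (@frob F E).
Local Notation Xn := ('X^n - 1 : {poly F}).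

Lemma ftraceEfrob (x : E) : (ftrace x)%:A = \sum_(i < n) iter i sigma x.
Proof. by rewrite ftraceE; apply: eq_bigr => i _; rewrite frobX. Qed.

Lemma iter_frobD k (x y : E) : iter k sigma (x + y) = iter k sigma x + iter k sigma y.
Proof. by rewrite -!frobX expcardD. Qed.

Lemma iter_frobM k (x y : E) : iter k sigma (x * y) = iter k sigma x * iter k sigma y.
Proof. by rewrite -!frobX exprMn. Qed.

Lemma iter_frob_mod (m1 m2 : nat) (x : E) : m1 = m2 %[mod n] ->
  iter m1 sigma x = iter m2 sigma x.
Proof.
move=> eq_m; have /(frobp_dvd0 x) := cyc_eqXn F eq_m.
by rewrite frobpD frobpN !frobpXn => /eqP; rewrite subr_eq0 => /eqP.
Qed.

Lemma iter_frob_frobp k f (x : E) : iter k sigma (frobp f x) = frobp ('X^k * f) x.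
Proof. by rewrite frobpM frobpXn. Qed.

Lemma ftrace_frob (x : E) : ftrace (sigma x) = ftrace x.
Proof.
apply: (fmorph_inj (in_alg E)); rewrite /= !ftraceEfrob.
have := frob_id x; case: n => [|d] xd; first by rewrite !big_ord0.
rewrite [LHS]big_ord_recr [RHS]big_ord_recl /= -iterSr xd addrC; congr (_ + _).
by apply: eq_bigr => i _; rewrite -iterSr.
Qed.

Lemma ftrace_iter k (x : E) : ftrace (iter k sigma x) = ftrace x.
Proof. by elim: k => //= k; rewrite ftrace_frob. Qed.

(** The trace is 1 + X + ... + X^(n-1) evaluated at the Frobenius; this polynomial is nonzero of
    degree below n, so some y has nonzero trace, and y is a multiple of [x] if [x] is nonzero. *)
Lemma ftrace_nondegenerate (x : E) : (forall y, ftrace (y * x) = 0) -> x = 0.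
Proof.
move=> trx; apply/eqP/idPn => nzx.
pose f : {poly F} := \poly_(i < n) 1.
have nzf : f != 0.
  apply/eqP => /(congr1 (fun p : {poly F} => p`_0)).
  by rewrite coef_poly adim_gt0 coef0 => /eqP; rewrite oner_eq0.
have [y] := frobp_neq0 nzf (size_poly _ _).
rewrite (frobpE _ (size_poly _ _)) (eq_bigr (fun i : 'I_n => iter i sigma y)).
  by rewrite -ftraceEfrob -(divfK nzx y) trx scale0r eqxx.
by move=> i _; rewrite coef_poly ltn_ord scale1r.
Qed.

Hypothesis n_gt1 : (1 < n)%N.
Let n_gt0 : (0 < n)%N. Proof. exact: ltnW. Qed.

(** The trace is invariant under sigma, so the adjoint of sigma^i is its inverse, written
    sigma^((n-1)i). *)
Lemma ftrace_adjoint f (x y : E) :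
  ftrace (x * frobp f y) = ftrace (frobp (cycbar n f) x * y).
Proof.
rewrite /cycbar comp_polyE !frobp_sum (frobpE y (leqnn (size f))).
rewrite mulr_sumr mulr_suml.
have tr_sum (g : 'I_(size f) -> E) : ftrace (\sum_i g i) = \sum_i ftrace (g i).
  apply: (big_morph _ (@ftraceD F E)).
  by have := @ftraceZ F E 0 0; rewrite scale0r mul0r.
rewrite !tr_sum; apply: eq_bigr => i _.
rewrite frobpZ -scalerAl -scalerAr !ftraceZ; congr (_ * _).
rewrite -(ftrace_iter (n.-1 * i)) iter_frobM -exprM frobpXn -iterD.
by rewrite -mulSnr prednK // (@iter_frob_mod (n * i) 0) ?modnMr ?mod0n.
Qed.

(** The coefficient of X^l in the residue of [f] modulo X^n - 1 is the constant coefficient of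
    X^(-l) f, with n-1 standing for -1. *)
Lemma frobp_cyc0 f (x : E) :
  frobp f x = \sum_(l < n) cyc0 n ('X^(n.-1 * l) * f) *: iter l sigma x.
Proof.
have fE : \sum_(i < size f) f`_i *: 'X^i = f by rewrite -poly_def coefK.
rewrite (frobpE x (leqnn (size f))).
under [RHS]eq_bigr => l _.
  rewrite -{1}fE mulr_sumr cyc0_sum scaler_suml.
  under eq_bigr => i _ do rewrite -scalerAr cyc0Z -exprD cyc0Xn // -scalerA.
  over.
rewrite exchange_big /=; apply: eq_bigr => i _; rewrite -scaler_sumr.
congr (_ *: _); pose l0 := Ordinal (ltn_pmod i n_gt0).
have dvdE (l : 'I_n) : (n %| n.-1 * l + i)%N = (l == l0).
  rewrite /dvdn -(mod0n n) -(eqn_modDr l) add0n addnAC -mulSnr prednK //.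
  by rewrite mulnC modnMDl [(l %% n)%N]modn_small // eq_sym.
rewrite (bigD1 l0) // dvdE eqxx scale1r big1 => [|l lnl0].
  by rewrite [RHS]addr0; apply: iter_frob_mod; rewrite modn_mod.
by rewrite dvdE (negPf lnl0) scale0r.
Qed.

(** * The Gram determinant of the trace form on a normal element *)

Section Gram.

Hypothesis oddF : odd #|F|.
Variables (L H D G : {poly F}) (k : nat).
Hypotheses (symL : Xn %| cycbar n L - L) (DH : D * H = Xn) (DL : D %| L).
Hypotheses (monH : H \is monic) (szH : size H = k.+2).
Hypotheses (GL : Xn %| L - G * D) (regL : forall v, Xn %| L * v -> H %| v).

Definition traceform (x y : E) : F := ftrace (x * frobp L y).

Lemma traceformC x y : traceform x y = traceform y x.
Proof.
rewrite /traceform ftrace_adjoint mulrC; congr (ftrace (_ * _)).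
by rewrite -[X in frobp X _](subrK L) frobpD frobp_dvd0 ?add0r.
Qed.

Lemma traceform_linear x : linear_for *%R (traceform x).
Proof.
move=> c y z; rewrite /traceform frobprD frobprZ mulrDr -scalerAr.
by rewrite ftraceD ftraceZ.
Qed.

(** Normality of [b] gives x = f(sigma) b. Since X^n - 1 divides [L * H], multiples of [H]
    contribute only to the radical, and [f] may be reduced modulo [H]. *)
Lemma traceform_span (b : E) : (forall f, frobp f b = 0 <-> Xn %| f) ->
  forall x, exists f : 'rV_k.+1,
    forall y, traceform y x = traceform y (frobp (rVpoly f) b).
Proof.
move=> bP x; pose X := [tuple of mkseq (fun i => iter i sigma b) n].
have Xn0 (i : 'I_n) : X`_i = iter i sigma b by rewrite nth_mkseq.
have freeX : free X.
  apply/freeP => c c0 i; pose f := \poly_(i < n) (if insub i is Some j then c j else 0).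
  have fE (j : 'I_n) : f`_j = c j by rewrite coef_poly ltn_ord valK.
  have /bP/dvdp_leq : frobp f b = 0.
    rewrite (frobpE _ (size_poly _ _)) -[RHS]c0; apply: eq_bigr => j _.
    by rewrite fE Xn0.
  rewrite size_XnsubC // ltnNge size_poly -fE.
  by have [->|_ /(_ isT)] := eqVneq f 0; rewrite ?coef0.
have basisX : basis_of {:E} X by rewrite basisEfree freeX subvf size_tuple /=.
have [f xE] : exists f : {poly F}, x = frobp f b.
  exists (\sum_(i < n) coord X i x *: 'X^i); rewrite frobp_sum.
  rewrite [LHS](coord_basis basisX (memvf x)); apply: eq_bigr => i _.
  by rewrite frobpZ frobpXn Xn0.
exists (poly_rV (f %% H)) => y; rewrite poly_rV_modK // xE /traceform.
rewrite [in LHS](divp_eq f H) frobpD frobprD -frobpM [X in X + _]frobp_dvd0 ?add0r //.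
have [g ->] := dvdpP _ _ DL; rewrite [_ * H]mulrC -!mulrA [D * _]mulrA DH.
by rewrite dvdp_mull // dvdp_mulr.
Qed.

Local Notation C := (modmx k H).

Lemma modmx_order : C ^+ n = 1.
Proof.
have: horner_mx C Xn == 0 by rewrite horner_modmx_eq0 // -DH dvdp_mull.
by rewrite rmorphB rmorphXn rmorph1 /= horner_mx_X subr_eq0 => /eqP.
Qed.

Definition gram (b : E) :=
  \matrix_(i < k.+1, j < k.+1) traceform (iter i sigma b) (iter j sigma b).

(** A kernel vector [v] puts v(sigma) b in the radical, so L(sigma) v(sigma) b = 0 and X^n - 1
    divides [L * rVpoly v]; by [regL], [H] then divides a polynomial of smaller size. *)
Lemma gram_neq0 (b : E) : (forall f, frobp f b = 0 <-> Xn %| f) -> \det (gram b) != 0.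
Proof.
move=> bP; apply/det0P => -[v nzv v0].
have vE : frobp (rVpoly v) b = \sum_(i < k.+1) v 0 i *: iter i sigma b.
  rewrite (frobpE _ (size_poly _ _)); apply: eq_bigr => i _.
  by rewrite coef_rVpoly_ord.
have Blin x : linear_for *%R (traceform x) := @traceform_linear x.
have BD x y z : traceform x (y + z) = traceform x y + traceform x z.
  by have := Blin x 1 y z; rewrite scale1r mul1r.
have B0 x : traceform x 0 = 0 by apply/(addrI (traceform x 0)); rewrite -BD !addr0.
have BZ x c y : traceform x (c *: y) = c * traceform x y.
  by have := Blin x c y 0; rewrite !addr0 B0 addr0.
have Bsum x (f : 'I_k.+1 -> E) : traceform x (\sum_i f i) = \sum_i traceform x (f i).
  exact: (big_morph (traceform x) (BD x) (B0 x)).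
have rad y : traceform y (frobp (rVpoly v) b) = 0.
  rewrite traceformC vE; set u := \sum_i _.
  have [f ->] := traceform_span bP y.
  rewrite (frobpE _ (size_poly _ _)) Bsum big1 // => j _; rewrite BZ traceformC Bsum.
  have /rowP/(_ j) := v0; rewrite !mxE => v0j; rewrite [X in _ * X](_ : _ = 0) ?mulr0 //.
  by rewrite -[RHS]v0j; apply: eq_bigr => i _; rewrite BZ mxE traceformC.
have /ftrace_nondegenerate : forall y, ftrace (y * frobp (L * rVpoly v) b) = 0.
  by move=> y; rewrite frobpM; exact: rad.
move/bP/regL => Hv; case/eqP: nzv; apply: (can_inj rVpolyK); rewrite linear0.
apply/eqP/idPn => nzv; have := dvdp_leq nzv Hv.
by rewrite szH ltnNge size_poly.
Qed.

(* Over E the Gram matrix factors as b(C) Lam b(C)^T, with Lam the matrix of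
   the cyclic form and b(X) the sum of the (sigma^l b) X^l; N is the
   determinant of b(C), and sigma acts on b(C) as multiplication by C^-1. *)
Lemma gram_det (b : E) : exists N : E,
  (\det (gram b))%:A = N ^+ 2 * (\det (horner_mx C G) * D`_0 ^+ k.+1)%:A
  /\ (\det C)%:A * N ^+ #|F| = N.
Proof.
pose toE (M : 'M[F]_k.+1) : 'M[E]_k.+1 := map_mx (in_alg E) M.
have toEM M1 M2 : toE (M1 *m M2) = toE M1 *m toE M2 by exact: map_mxM.
pose bC := \sum_(l < n) iter l sigma b *: toE (C ^+ l).
(* The transpose aligns the indices: applying sigma^(-i) under the trace leaves X^(j-i) L, which
   gives entry (j, i) of the cyclic form. *)
have gramE : toE (gram b)^T = bC *m toE (cycform_mx n L k) *m bC^T.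
  have -> : bC *m toE (cycform_mx n L k) *m bC^T = \sum_(s < n) \sum_(t < n)
      (iter s sigma b * iter t sigma b)
        *: toE (C ^+ s *m cycform_mx n L k *m (C ^+ t)^T).
    rewrite /bC !mulmx_suml; apply: eq_bigr => s _.
    rewrite raddf_sum mulmx_sumr; apply: eq_bigr => t _ /=.
    rewrite !toEM linearZ /= -!scalemxAl -scalemxAr scalerA.
    by rewrite [(toE _)^T]map_trmx mulrC.
  apply/matrixP => j i; rewrite summxE.
  have -> : toE (gram b)^T j i = (ftrace (b * frobp ('X^(n.-1 * i + j) * L) b))%:A.
    rewrite !mxE /traceform -(ftrace_iter (n.-1 * i)) iter_frobM -iterD.
    rewrite -mulSnr prednK // (@iter_frob_mod (n * i) 0) ?modnMr ?mod0n //=.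
    by rewrite iter_frob_frobp -[in LHS](frobpXn j) -frobpM exprD -!mulrA [L * _]mulrC.
  (* The sum over s is the trace itself; the sum over t is the expansion of the Frobenius polynomial
     applied to [b]. *)
  rewrite ftraceEfrob; apply: eq_bigr => s _; rewrite summxE.
  rewrite iter_frobM iter_frob_frobp frobp_cyc0 mulr_sumr; apply: eq_bigr => t _.
  rewrite (modmxX_cycform n_gt1 symL DH DL monH szH) !mxE -scalerAr -mulrA.
  rewrite mulr_algr -scalerAr; congr (cyc0 _ _ *: _); rewrite !mulrA -!exprD.
  congr ('X^_ * _); rewrite mulnDr addnC -!addnA addnCA; congr addn.
  by rewrite addnCA [RHS]addnC addnCA addnA.
exists (\det bC); split.
  have := congr1 (fun M => \det M) gramE.
  rewrite !det_mulmx !det_tr det_map_mx det_tr /= => ->.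
  by rewrite mulrAC -expr2 det_map_mx (det_cycform_mx n_gt1 DH monH szH GL).
(* The entries of C are fixed by sigma, so C sigma(b(C)) only shifts the summation index, which is
   cyclic because C^n = 1 and sigma^n = 1. *)
have frobC : toE C *m map_mx sigma bC = bC.
  have sig1 (M : 'M[F]_k.+1) : map_mx sigma (toE M) = toE M.
    apply/matrixP => i j; rewrite !mxE /frob exprZn expf_card.
    by rewrite expr1n.
  pose g l := iter l sigma b *: toE (C ^+ l).
  have shift : \sum_(l < n) g l.+1 = \sum_(l < n) g l.
    have: g n = g 0%N by rewrite /g modmx_order frob_id.
    case: n => [|d] gd; first by rewrite !big_ord0.
    by rewrite big_ord_recr [RHS]big_ord_recl /= gd addrC.
  rewrite /bC raddf_sum mulmx_sumr -[RHS]shift; apply: eq_bigr => l _.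
  rewrite /g exprS toEM scalemxAr -[in RHS](sig1 (C ^+ l)); congr (_ *m _).
  by apply/matrixP => i j; rewrite !mxE /= /frob exprMn.
have := congr1 (fun M => \det M) frobC.
by rewrite det_mulmx !det_map_mx.
Qed.

(** By Euler's criterion [eps] is the power (q-1)/2 of the Gram determinant; there the factor N^2
    becomes N^(q-1), the inverse of det C. *)
Lemma traceform_invariant (Q : E -> F) (eps : int) :
  (forall x, Q x = traceform x x) -> qform_invariant Q eps ->
  (eps = 1 \/ eps = -1) /\
  \det C * eps%:~R = (\det (horner_mx C G) * D`_0 ^+ k.+1) ^+ ((#|F| - 1) %/ 2).
Proof.
move=> QE epsP; have [b bP] := normal_element E.
have gram_nz := gram_neq0 bP.
have -> : eps = quad_char (\det (gram b)).
  apply: (qform_invariant_gram oddF traceformC traceform_linear QE) => // x.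
  have [f fP] := traceform_span bP x; exists (fun i => f 0 i) => y; rewrite fP.
  congr (traceform y _); rewrite (frobpE _ (size_poly _ _)).
  by apply: eq_bigr => i _; rewrite coef_rVpoly_ord.
split; first exact: quad_char_neq0.
rewrite -euler_criterion //; apply: (fmorph_inj (in_alg E)).
have [N [gN CN]] := gram_det b.
rewrite rmorphM [in LHS]rmorphXn /= gN exprMn -exprM -card_half //.
have nzN : N != 0.
  apply: contraNneq gram_nz => N0; apply/eqP/(fmorph_inj (in_alg E)).
  by rewrite /= gN N0 expr0n mul0r scale0r.
have CN1 : (\det C)%:A * N ^+ #|F|.-1 = 1.
  apply: (mulIf nzN); rewrite -mulrA -exprSr mul1r prednK //.
  by rewrite ltnW // finNzRing_gt1.
by rewrite mulrA CN1 mul1r -[RHS]/(in_alg E _) rmorphXn.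
Qed.

End Gram.

End TraceForm.

(** * Reciprocal polynomials *)

Section ReciprocalPolynomial.

Variable F : fieldType.
Implicit Types p : {poly F}.

(** This is X^m p(1/X) when [p] has degree at most m. The formal degree is explicit so that reversal
    is multiplicative, as in [revpM]. *)
Definition revp (m : nat) (p : {poly F}) := \poly_(i < m.+1) p`_(m - i).

Lemma coef_revp m p i : (i <= m)%N -> (revp m p)`_i = p`_(m - i).
Proof. by move=> le_im; rewrite coef_poly ltnS le_im. Qed.

Lemma size_revp m p : (size (revp m p) <= m.+1)%N.
Proof. exact: size_poly. Qed.

Lemma revpE m p : revp m p = \sum_(i < m.+1) p`_i *: 'X^(m - i).
Proof.
rewrite /revp poly_def (reindex_inj rev_ord_inj) /=; apply: eq_bigr => i _.
by rewrite subSS subKn // -ltnS.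
Qed.

Lemma revp_sum m I (s : seq I) (f : I -> {poly F}) :
  revp m (\sum_(i <- s) f i) = \sum_(i <- s) revp m (f i).
Proof.
apply: (big_morph (revp m)) => [p1 p2|]; apply/polyP => i; last first.
  by rewrite coef_poly !coef0 if_same.
by rewrite coefD !coef_poly coefD; case: ifP; rewrite ?addr0.
Qed.

Lemma revpZ m c p : revp m (c *: p) = c *: revp m p.
Proof.
by apply/polyP => i; rewrite coefZ !coef_poly coefZ; case: ifP; rewrite ?mulr0.
Qed.

Lemma revpXn m i : (i <= m)%N -> revp m 'X^i = 'X^(m - i).
Proof.
move=> le_im; apply/polyP => j; rewrite coef_poly !coefXn.
case: ltnP => [|lt_mj]; last first.
  by rewrite gtn_eqF // (leq_ltn_trans (leq_subr _ _)).
rewrite ltnS => le_jm; congr (_%:R); congr nat_of_bool.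
by rewrite -(eqn_add2r j) subnK // -[RHS](eqn_add2r i) subnK // addnC eq_sym.
Qed.

Lemma revpM m l p1 p2 : (size p1 <= m.+1)%N -> (size p2 <= l.+1)%N ->
  revp (m + l) (p1 * p2) = revp m p1 * revp l p2.
Proof.
have polyE (p : {poly F}) t : (size p <= t)%N -> p = \sum_(i < t) p`_i *: 'X^i.
  move=> szp; rewrite -poly_def; apply/polyP => i; rewrite coef_poly.
  by case: ltnP => // le_ti; rewrite nth_default // (leq_trans szp).
move=> sz1 sz2; rewrite {1}(polyE _ _ sz1) {1}(polyE _ _ sz2) mulr_suml revp_sum.
rewrite !revpE mulr_suml; apply: eq_bigr => i _.
rewrite !mulr_sumr revp_sum; apply: eq_bigr => j _.
have [le_im le_jl] : (i <= m)%N /\ (j <= l)%N by split; rewrite -ltnS.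
rewrite -!scalerAl -!scalerAr -!exprD !revpZ revpXn ?leq_add //.
by rewrite addnBA // addnBAC // subnDA.
Qed.

Lemma horner_revpN1 m p : (size p <= m.+1)%N ->
  (revp m p).[-1] = (-1) ^+ m * p.[-1].
Proof.
move=> szp; rewrite (horner_coef_wide _ szp) revpE horner_sum mulr_sumr.
apply: eq_bigr => i _; rewrite hornerZ hornerXn mulrCA; congr (_ * _).
have le_im : (i <= m)%N by rewrite -ltnS.
by rewrite -[X in _ = _ ^+ X * _](subnK le_im) exprD -mulrA -expr2 sqrr_sign mulr1.
Qed.

Lemma revp_XaddC1X (m : nat) : revp m (('X - (-1)%:P) ^+ m) = ('X - (-1)%:P) ^+ m.
Proof.
elim: m => [|m IHm].
  by apply/polyP => i; rewrite expr0 coef_poly; case: i => [|i]; rewrite ?coef1.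
rewrite exprSr -[in LHS]addn1 revpM ?size_XsubC ?size_exp_XsubC // IHm; congr (_ * _).
apply/polyP => i; rewrite coef_poly; case: i => [|[|i]] //=.
all: by rewrite !coefB !coefX !coefC ?subr0 ?sub0r ?opprK.
Qed.

(** The factor (X+1)^mu is palindromic, so its cofactor is again self-reciprocal up to [c]. The
    cofactor does not vanish at -1, and evaluating there gives [c] as -1 to the power of its
    degree. *)
Lemma selfrev_sign (e : nat) (D : {poly F}) (c : F) :
  D != 0 -> size D = e.+1 -> revp e D = c *: D ->
  (mup (-1) D <= e)%N /\ c = (-1) ^+ (e - mup (-1) D).
Proof.
move=> nzD szD revD; set mu := mup _ _.
have : ('X - (-1)%:P) ^+ mu %| D by rewrite -mup_geq.
case/dvdpP=> D1 DE.
have nzD1 : D1 != 0 by apply: contraNneq nzD => D0; rewrite DE D0 mul0r.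
have szD1 : (size D1 + mu = e.+1)%N.
  by rewrite -szD DE size_mul ?expf_neq0 ?polyXsubC_eq0 // size_exp_XsubC addnS.
have D1_gt0 : (0 < size D1)%N by rewrite size_poly_gt0.
have le_mu : (mu <= e)%N by rewrite -ltnS -szD1 -addn1 addnC leq_add2r.
split=> //; have sz1 : size D1 = (e - mu).+1.
  by apply/eqP; rewrite -(eqn_add2r mu) szD1 addSn subnK.
have rev1 : revp (e - mu) D1 = c *: D1.
  have nzX : ('X - (-1)%:P) ^+ mu != 0 :> {poly F} by rewrite expf_neq0 ?polyXsubC_eq0.
  apply: (mulIf nzX); rewrite -scalerAl -DE -revD [in RHS]DE.
  by rewrite -[in RHS](subnK le_mu) revpM ?sz1 ?size_exp_XsubC // revp_XaddC1X.
have D1N1 : D1.[-1] != 0.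
  apply/negP => /(factor_theorem D1 (-1))[D2 D2E].
  have : ('X - (-1)%:P) ^+ mu.+1 %| D by rewrite DE D2E exprS -mulrA dvdp_mull.
  by rewrite -mup_geq // ltnn.
apply: (mulIf D1N1); rewrite -horner_revpN1 ?sz1 //.
by rewrite rev1 hornerZ.
Qed.

(** Reversal in formal degree n only moves the constant term, from X^0 to X^n. *)
Lemma revp_palindrome (n : nat) (L : {poly F}) : (0 < n)%N -> (size L <= n)%N ->
  (forall i, (0 < i < n)%N -> L`_(n - i) = L`_i) ->
  revp n L = L + L`_0 *: ('X^n - 1).
Proof.
move=> n_gt0 szL symL; apply/polyP => i.
rewrite coef_poly coefD coefZ coefB coefXn coef1 ltnS.
have Ln : L`_n = 0 by rewrite nth_default.
case: ltngtP => [lt_in||->]; last by rewrite subnn Ln gtn_eqF // subr0 mulr1 add0r.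
  case: i lt_in => [|i] lt_in; first by rewrite subn0 Ln sub0r mulrN1 subrr.
  by rewrite subr0 mulr0 addr0 symL.
move=> lt_ni; rewrite nth_default ?(leq_trans szL (ltnW lt_ni)) //.
by rewrite gtn_eqF ?(leq_ltn_trans _ lt_ni) // subr0 mulr0 addr0.
Qed.

(** Modulo X^n - 1, substituting X^(n-1) for X amounts to reversal in formal degree n. *)
Lemma cycbar_palindrome (n : nat) (L : {poly F}) : (1 < n)%N -> (size L <= n)%N ->
  (forall i, (0 < i < n)%N -> L`_(n - i) = L`_i) ->
  'X^n - 1 %| cycbar n L - L.
Proof.
move=> n_gt1 szL symL; have n_gt0 := ltnW n_gt1.
have barE : cycbar n L = \sum_(i < n.+1) L`_i *: 'X^(n.-1) ^+ i.
  rewrite /cycbar comp_polyE (big_ord_widen n.+1 (fun i => L`_i *: 'X^(n.-1) ^+ i)).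
    rewrite [LHS]big_mkcond; apply: eq_bigr => i _; case: ltnP => // le_i.
    by rewrite nth_default // scale0r.
  by rewrite (leq_trans szL).
have bar_rev : 'X^n - 1 %| cycbar n L - revp n L.
  rewrite barE revpE -sumrB.
  apply: (big_ind (dvdp ('X^n - 1))) => [|u v|i _]; [exact: dvdp0|exact: dvdp_add|].
  rewrite -scalerBr -mul_polyC dvdp_mull // -exprM cyc_eqXn //.
  have le_in : (i <= n)%N by rewrite -ltnS.
  apply/eqP; rewrite -(eqn_modDr i) subnK // -mulSnr prednK //.
  by rewrite modnn modnMr.
have -> : cycbar n L - L = (cycbar n L - revp n L) + L`_0 *: ('X^n - 1).
  by rewrite revp_palindrome // opprD addrA subrK.
by rewrite dvdp_add // -mul_polyC dvdp_mull.
Qed.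

(** Reversal keeps [L] and X^n - 1 in the ideal they generate, so the reversed [D] is a common
    divisor too. It has full size because D(0) is nonzero, hence is a scalar multiple of [D]; the
    two extreme coefficients determine the scalar and its square. *)
Lemma revp_gcd (n e : nat) (L D : {poly F}) : (0 < n)%N -> (size L <= n)%N ->
    (forall i, (0 < i < n)%N -> L`_(n - i) = L`_i) ->
    D \is monic -> size D = e.+1 -> D %| L -> D %| 'X^n - 1 ->
    (forall p, p %| L -> p %| 'X^n - 1 -> p %| D) ->
  revp e D = D`_0 *: D /\ D`_0 ^+ 2 = 1.
Proof.
move=> n_gt0 szL symL monD szD DL DX Dmax; have nzD := monic_neq0 monD.
have lead1 : D`_e = 1 by move/monicP: monD; rewrite lead_coefE szD.
have nzX : 'X^n - 1 != 0 :> {poly F} by rewrite monic_neq0 // monicXnsubC.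
have szX : size ('X^n - 1 : {poly F}) = n.+1 by rewrite size_XnsubC.
have le_en : (e <= n)%N by rewrite -ltnS -szD -szX dvdp_leq.
have revdvd (p : {poly F}) : (size p <= n.+1)%N -> D %| p -> revp e D %| revp n p.
  move=> szp /dvdpP[g gE].
  have [g0|nzg] := eqVneq g 0.
    rewrite gE g0 mul0r [revp n 0](_ : _ = 0) ?dvdp0 //.
    by apply/polyP => i; rewrite coef_poly !coef0 if_same.
  rewrite -(subnK le_en) gE revpM ?szD ?dvdp_mull //.
  by move: szp; rewrite gE size_mul // szD addnS /= => szg; rewrite -(leq_add2r e) addSn subnK.
have revX : revp n ('X^n - 1) = - ('X^n - 1).
  apply/polyP => i; rewrite coef_poly coefN !coefB !coefXn !coef1 ltnS.
  case: ltngtP => [lt_in||->].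
  - rewrite subn_eq0 [(n <= i)%N]leqNgt lt_in /=.
    case: i lt_in => [|i] lt_in; first by rewrite subn0 eqxx subr0 sub0r opprK.
    have -> : (n - i.+1 == n)%N = false by rewrite ltn_eqF // ltn_subrL n_gt0.
    by rewrite subrr oppr0.
  - by move=> lt_ni; rewrite gtn_eqF ?(leq_ltn_trans _ lt_ni) // subrr oppr0.
  by rewrite subnn eqxx (ltn_eqF n_gt0) (gtn_eqF n_gt0) sub0r subr0.
have rX : revp e D %| 'X^n - 1 by rewrite -dvdpNr -revX revdvd ?szX.
have rL : revp e D %| L.
  have: revp e D %| revp n L by rewrite revdvd // (leq_trans szL).
  by rewrite (@revp_palindrome n L) // -mul_polyC dvdp_addl // dvdp_mull.
have rD := Dmax _ rL rX.
have nzD0 : D`_0 != 0.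
  rewrite -horner_coef0; apply/negP => /(root_dvdp DX).
  by rewrite /root !hornerE expr0n gtn_eqF // sub0r oppr_eq0 oner_eq0.
have szr : size (revp e D) = e.+1.
  apply/eqP; rewrite eqn_leq size_revp ltnNge; apply: contra nzD0 => szr.
  by rewrite -(subnn e) -coef_revp // nth_default.
have : revp e D %= D by rewrite -dvdp_size_eqp // szr szD.
move=> /eqpf_eq[c nzc cE].
have cD : c = D`_0.
  have := congr1 (fun p : {poly F} => p`_e) cE.
  by rewrite /= coefZ coef_revp // subnn lead1 mulr1 => ->.
rewrite cE cD; split=> //.
have := congr1 (fun p : {poly F} => p`_0) cE.
by rewrite /= coefZ coef_revp // subn0 lead1 cD expr2 => ->.
Qed.

End ReciprocalPolynomial.

(** * Linearized polynomials *)

Lemma coef_linearized (R : nzRingType) (q k : nat) (c : nat -> R) (j : nat) :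
  (1 < q)%N -> (j < k)%N -> (\sum_(i < k) c i *: 'X^(q ^ i))`_(q ^ j) = c j.
Proof.
move=> q1 lt_jk; rewrite coef_sum (bigD1 (Ordinal lt_jk)) //= big1 => [|i ne_ij].
  by rewrite addr0 coefZ coefXn eqxx mulr1.
by rewrite coefZ coefXn eqn_exp2l // eq_sym [_ == _](negPf ne_ij) mulr0.
Qed.

Section LinearizedPolynomial.

Variables (F : finFieldType) (E : fieldExtType F) (ell : {poly E}).
Local Notation q := #|F|.
Local Notation n := (\dim {:E}).
Local Notation sigma := (@frob F E).
Hypotheses (ell_lin : qlinear q ell) (ell_deg : (size ell <= q ^ n)%N).

Let q1 : (1 < q)%N. Proof. exact: finNzRing_gt1. Qed.
Let n_gt0 : (0 < n)%N. Proof. exact: adim_gt0. Qed.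

Lemma qlinear_coefE : ell = \sum_(i < n) ell`_(q ^ i) *: 'X^(q ^ i).
Proof.
apply/polyP => t.
have [/existsP[i /eqP <-]|] := boolP [exists i : 'I_n, q ^ i == t]%N.
  by rewrite (coef_linearized (fun i => ell`_(q ^ i)) q1).
rewrite negb_exists => /forallP noq; rewrite coef_sum big1 => [|i _]; last first.
  by rewrite coefZ coefXn eq_sym (negPf (noq i)) mulr0.
have [lt_t|le_t] := ltnP t (size ell); last by rewrite nth_default.
have lt_tq := leq_trans lt_t ell_deg.
have [k [b ->]] := ell_lin; rewrite coef_sum big1 // => i _.
rewrite coefZ coefXn; case: eqP => [tE|_]; last by rewrite mulr0.
have lt_in : (i < n)%N by rewrite -(ltn_exp2l _ _ q1) -tE.
by have := noq (Ordinal lt_in); rewrite /= -tE eqxx.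
Qed.

(** The index is reduced modulo n so that the separate linear term, i = 0, fits the general
    formula. *)
Lemma qadjoint_coefE :
  qadjoint q n ell = \sum_(i < n) iter i sigma ell`_(q ^ ((n - i) %% n)) *: 'X^(q ^ i).
Proof.
rewrite -(big_mkord predT (fun i => iter i sigma ell`_(q ^ ((n - i) %% n)) *: 'X^(q ^ i))).
rewrite big_ltn // subn0 modnn expn0 expr1 /=; congr (_ + _).
rewrite big_nat_rev big_nat [RHS]big_nat; apply: eq_bigr => i /andP[i_gt0 lt_in].
rewrite add1n subSS (subKn (ltnW lt_in)) modn_small ?ltn_subrL ?i_gt0 //.
by rewrite exprZn frobX.
Qed.

Hypothesis oddF : odd q.
Variable a : 'I_n -> F.
Hypothesis L_coef : qsym q n ell = \sum_(i < n) (a i)%:A *: 'X^(q ^ i).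
Let L := \sum_(i < n) a i *: 'X^i.

Let nz2 : 2%:R != 0 :> E.
Proof. by rewrite -(rmorph_nat (in_alg E)) fmorph_eq0 natr2_neq0. Qed.

Lemma coef_qsymL (i : 'I_n) : L`_i = a i.
Proof.
rewrite coef_sum (bigD1 i) //= big1 => [|j ne_ji].
  by rewrite addr0 coefZ coefXn eqxx mulr1.
by rewrite coefZ coefXn eq_sym [_ == _](negPf ne_ji) mulr0.
Qed.

Lemma size_qsymL : (size L <= n)%N.
Proof.
rewrite (leq_trans (size_sum _ _ _)) //; apply/bigmax_leqP => i _.
by rewrite (leq_trans (size_scale_leq _ _)) // size_polyXn.
Qed.

Lemma qsymL_coef i : (i < n)%N ->
  (L`_i *+ 2)%:A = ell`_(q ^ i) + iter i sigma ell`_(q ^ ((n - i) %% n)).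
Proof.
move=> lt_in; have := congr1 (fun p : {poly E} => p`_(q ^ i)) L_coef.
have -> : \sum_(i < n) (a i)%:A *: 'X^(q ^ i)
    = \sum_(i < n) (L`_i)%:A *: 'X^(q ^ i) :> {poly E}.
  by apply: eq_bigr => j _; rewrite coef_qsymL.
rewrite /= (coef_linearized (fun i => (L`_i)%:A) q1) // /qsym coefZ coefD.
pose c i := iter i sigma ell`_(q ^ ((n - i) %% n)).
rewrite qadjoint_coefE (coef_linearized c q1) //.
move/(canRL (mulVKf nz2)) => ->.
by rewrite mulr_natl scalerMnl.
Qed.

(** Elements of F are fixed by sigma; applying sigma^i to [qsymL_coef] at n-i exchanges its two
    summands and yields the formula at i. *)
Lemma qsymL_palindrome i : (0 < i < n)%N -> L`_(n - i) = L`_i.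
Proof.
case/andP=> i_gt0 lt_in; have le_in := ltnW lt_in.
have n2 := natr2_neq0 oddF.
apply: (mulIf n2); rewrite !mulr_natr; apply: (fmorph_inj (in_alg E)).
have iterA k (c : F) : iter k sigma (c%:A) = c%:A.
  by elim: k => //= k ->; rewrite /frob exprZn expf_card expr1n.
rewrite /= -[LHS](iterA i) !qsymL_coef ?ltn_subrL ?i_gt0 // subKn //.
rewrite iter_frobD -iterD addnC subnK // frob_id addrC.
by rewrite (modn_small lt_in) (@modn_small (n - i)) // ltn_subrL i_gt0.
Qed.

(** Applying sigma^i under the trace turns the term of index n-i of [ell] into the term of index i
    of its companion, so both have the same trace form, and so does their half sum. *)
Lemma trace_qsym x : ftrace (x * ell.[x]) = ftrace (x * frobp L x).
Proof.
have tr_sum (g : 'I_n -> E) : ftrace (\sum_i g i) = \sum_i ftrace (g i).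
  apply: (big_morph _ (@ftraceD F E)).
  by have := @ftraceZ F E 0 0; rewrite scale0r mul0r.
have trE : ftrace (x * (qadjoint q n ell).[x]) = ftrace (x * ell.[x]).
  rewrite [in RHS]qlinear_coefE qadjoint_coefE !horner_sum !mulr_sumr !tr_sum.
  pose f (i : 'I_n) := Ordinal (ltn_pmod (n - i) n_gt0).
  rewrite [RHS](reindex_inj (h := f)); last first.
    move=> i j /(congr1 val) /= eq_ij; apply: val_inj => /=.
    have/eqP: (n - i = n - j %[mod n])%N by [].
    rewrite -(eqn_modDr (i + j)) addnA subnK 1?ltnW // [(i + j)%N]addnC addnA subnK 1?ltnW //.
    by rewrite !modnDl !modn_small // => /eqP.
  apply: eq_bigr => i _ /=; rewrite !hornerZ !hornerXn !frobX.
  rewrite -[in RHS](ftrace_iter i) !iter_frobM -iterD.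
  rewrite (@iter_frob_mod _ _ (i + (n - i) %% n) 0) /=; last first.
    by rewrite modnDmr subnKC ?modnn ?mod0n // ltnW.
  by rewrite [in LHS]mulrCA [in RHS]mulrCA [x * _]mulrC.
have := congr1 (horner^~ x) L_coef; rewrite /= horner_sum /qsym hornerZ hornerD.
have -> : \sum_(i < n) ((a i)%:A *: 'X^(q ^ i)).[x] = frobp L x.
  rewrite /L frobp_sum; apply: eq_bigr => i _.
  by rewrite frobpZ frobpXn hornerZ hornerXn frobX mulr_algl.
move/(canRL (mulVKf nz2)) => eqs.
apply: (mulfI (natr2_neq0 oddF)); rewrite -[RHS]ftraceZ scaler_nat -mulrnAr.
by rewrite -[frobp L x *+ 2]mulr_natl -eqs mulrDr ftraceD trE mulr_natl.
Qed.

End LinearizedPolynomial.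

(** * Monic greatest common divisors *)

Section MonicGcd.

Variables (F : fieldType) (p1 p2 : {poly F}).
Hypothesis nz2 : p2 != 0.

Let nzlc : (lead_coef (gcdp p1 p2))^-1 != 0.
Proof. by rewrite invr_eq0 lead_coef_eq0 gcdp_eq0 negb_and nz2 orbT. Qed.

Lemma monic_gcdp_monic : monic_gcdp p1 p2 \is monic.
Proof.
by rewrite monicE lead_coefZ mulVf // -invr_eq0 nzlc.
Qed.

Lemma monic_gcdp_dvdl : monic_gcdp p1 p2 %| p1.
Proof. by rewrite dvdpZl // dvdp_gcdl. Qed.

Lemma monic_gcdp_dvdr : monic_gcdp p1 p2 %| p2.
Proof. by rewrite dvdpZl // dvdp_gcdr. Qed.

Lemma monic_gcdp_Bezout : exists u v, monic_gcdp p1 p2 = u * p1 + v * p2.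
Proof.
have [[u v] /= /eqpf_eq[c nzc uvE]] := Bezoutp p1 p2.
pose d := ((lead_coef (gcdp p1 p2))^-1 / c); exists (d *: u), (d *: v).
by rewrite -!scalerAl -scalerDr uvE scalerA divfK.
Qed.

Lemma monic_gcdp_max p : p %| p1 -> p %| p2 -> p %| monic_gcdp p1 p2.
Proof.
by move=> d1 d2; have [u [v ->]] := monic_gcdp_Bezout; rewrite dvdp_add ?dvdp_mull.
Qed.

End MonicGcd.

(** * The four formulas for the invariant *)

Lemma prodr_ord_split (R : comNzRingType) (n r : nat) (f : 'I_n -> R) :
  \prod_i f i = (\prod_(i < n | (i < r)%N) f i) * \prod_(i < n | (r <= i)%N) f i.
Proof.
rewrite (bigID (fun i : 'I_n => (i < r)%N)) /=; congr (_ * _).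
by apply: eq_bigl => i; rewrite -leqNgt.
Qed.

Theorem theorem3p4 (q n : nat) (F : finFieldType) (E : fieldExtType F)
    (hq : #|F| = q) (q_odd : odd q) (hE : \dim {:E} = n) (n_gt1 : (1 < n)%N)
    (ell : {poly E})
    (ell_lin : qlinear q ell) (ell_deg : (size ell <= q ^ n)%N)
    (ell_neq0 : ell != 0)
    (a : 'I_n -> F)
    (L_neq0 : qsym q n ell != 0)
    (L_coef : qsym q n ell = \sum_(i < n) (a i)%:A *: 'X^(q ^ i))
    (Ls : {poly F}) (hLs : Ls = \sum_(i < n) a i *: 'X^i)
    (D : {poly F}) (hD : D = monic_gcdp Ls ('X^n - 1))
    (K : closedFieldType) (iota : {rmorphism F -> K})
    (K_closure : algebraic_closure iota)
    (omega : 'I_n -> K)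
    (homega : 'X^n - 1 = \prod_(i < n) ('X - (omega i)%:P) :> {poly K})
    (r : nat) (r_gt0 : (0 < r)%N) (r_len : (r <= n)%N)
    (hr : map_poly iota D = \prod_(i < n | (r <= i)%N) ('X - (omega i)%:P))
    (G : {poly F})
    (hG : 'X^n - 1 %| map_poly iota Ls
            - map_poly iota G * \prod_(i < n | (r <= i)%N) ('X - (omega i)%:P))
    (eps : int)
    (heps : qform_invariant (fun x : E => ftrace (x * ell.[x])) eps) :
  [/\ D`_0 ^+ 2 = 1 /\
      (eps = 1 <->
       \prod_(j < n | (j < r)%N) (map_poly iota G).[omega j] ^+ ((q - 1) %/ 2)
       = (-1) ^+ (r - 1) * iota D`_0 ^+ ((q - 1) %/ 2 * r + 1)),
      exists P : F,
        iota P = \prod_(j < n | (j < r)%N) (map_poly iota G).[omega j] /\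
        eps = (-1) ^+ ((n - 1 - mup (-1) D) * ((q - 1) %/ 2 * r + 1)) * quad_char P,
      r = n ->
      exists P : F,
        iota P = \prod_(j < n) (map_poly iota Ls).[omega j] /\
        eps = (-1) ^+ (n - 1) * quad_char P
    & forall (m : nat) (b : E),
      (r = n - 2 * m)%N -> (r < n)%N ->
      size ell = (q ^ m).+1 -> lead_coef ell = b ->
      exists b0 : F,
        b0%:A = b /\
        eps = (-1) ^+ ((n - 1) * ((q - 1) %/ 2 * m + 1))
              * quad_char (2%:R * b0) ^+ n].
Proof.
case: r r_gt0 r_len hr hG => // k _ r_len hr hG.
have n_gt0 := ltnW n_gt1; subst q n.
set n := \dim _ in n_gt1 n_gt0 ell_deg a L_neq0 L_coef Ls hLs D hD omega homega r_len hr hG *.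
set q := #|F| in q_odd ell_lin ell_deg L_neq0 L_coef *.
set h := ((q - 1) %/ 2)%N.
have szXn : size ('X^n - 1 : {poly F}) = n.+1 by rewrite size_XnsubC.
have monXn : 'X^n - 1 \is @monic F by rewrite monicXnsubC.
have nzXn := monic_neq0 monXn.
have mapXn : map_poly iota ('X^n - 1) = 'X^n - 1.
  by rewrite rmorphB rmorph1 /= map_polyXn.
have monD : D \is monic by rewrite hD monic_gcdp_monic.
have DL : D %| Ls by rewrite hD monic_gcdp_dvdl.
have DX : D %| 'X^n - 1 by rewrite hD monic_gcdp_dvdr.
have nzD := monic_neq0 monD.
have [H HE] := dvdpP _ _ DX.
have DH : D * H = 'X^n - 1 by rewrite mulrC.
have monH : H \is monic by rewrite -(monicMl _ monD) DH.
have mapH : map_poly iota H = \prod_(i < k.+1) ('X - (omega (widen_ord r_len i))%:P).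
  have nzmD : map_poly iota D != 0 by rewrite map_poly_eq0.
  apply: (mulfI nzmD); rewrite -rmorphM DH /= mapXn homega.
  by rewrite (prodr_ord_split k.+1) (big_ord_narrow r_len) mulrC hr.
have szH : size H = k.+2.
  by rewrite -(size_map_poly iota) mapH -big_enum size_prod_XsubC size_enum_ord.
have szD : size D = (n - k.+1).+1.
  have := szXn; rewrite -DH size_mul ?monic_neq0 // szH addnS /= => szDH.
  by apply/eqP; rewrite -(eqn_add2r k.+1) szDH addSn subnK.
(* By Bezout, [D * v] is a combination of [Ls * v] and X^n - 1, hence divisible by [D * H]. *)
have regL v : 'X^n - 1 %| Ls * v -> H %| v.
  have [u [w bez]] := monic_gcdp_Bezout Ls ('X^n - 1); rewrite -hD in bez.
  move=> Lv; rewrite -(dvdp_mul2l _ _ nzD) DH bez mulrDl.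
  by apply: dvdp_add; rewrite -mulrA; apply: dvdp_mull => //; apply: dvdp_mulr.
have GL : 'X^n - 1 %| Ls - G * D.
  by rewrite -(dvdp_map iota) /= mapXn rmorphB rmorphM /= hr.
have szL : (size Ls <= n)%N by rewrite hLs size_qsymL.
have palL i : (0 < i < n)%N -> Ls`_(n - i) = Ls`_i.
  by rewrite hLs; apply: (qsymL_palindrome q_odd L_coef).
have symL : 'X^n - 1 %| cycbar n Ls - Ls by apply: cycbar_palindrome.
have Dmax p : p %| Ls -> p %| 'X^n - 1 -> p %| D by rewrite hD; apply: monic_gcdp_max.
have [revD c2] := revp_gcd n_gt0 szL palL monD szD DL DX Dmax.
have [le_mu cE] := selfrev_sign nzD szD revD.
have QE x : ftrace (x * ell.[x]) = traceform Ls x x.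
  by rewrite (trace_qsym ell_lin ell_deg q_odd L_coef) /traceform hLs.
have [eps1 epsE] := traceform_invariant n_gt1 q_odd symL DH DL monH szH GL regL QE heps.
rewrite -/q -/h in epsE.
set c := D`_0 in c2 cE epsE *; set P := \det (horner_mx _ G) in epsE.
set mu := mup _ D in le_mu cE *.
have H0 : H`_0 = - c.
  have : c * H`_0 = -1.
    have := congr1 (fun p : {poly F} => p.[0]) DH.
    rewrite /= hornerM !horner_coef0 coefB coefXn coef1 /= => ->.
    by rewrite ltn_eqF // sub0r.
  by move/(congr1 (fun x => c * x)); rewrite mulrA -expr2 c2 mul1r mulrN1.
have detC : \det (modmx k H) = (-1) ^+ k * c.
  by rewrite det_modmx // H0 exprS mulN1r mulrNN.
have iotaP : iota P = \prod_(j < n | (j < k.+1)%N) (map_poly iota G).[omega j].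
  rewrite (big_ord_narrow r_len).
  apply: (@det_map_horner_mx _ _ iota k _ (fun i => omega (widen_ord r_len i))).
  by rewrite char_poly_modmx.
have h_gt0 : (0 < h)%N.
  rewrite lt0n; apply/eqP => h0; have := finNzRing_gt1 F.
  by have := card_half q_odd; rewrite -/h h0; case: #|F| => [|[]].
(* This sign is det C times c^(hr), where r is [k.+1]; its square is 1, so it can be moved across
   equations. *)
pose s : F := (-1) ^+ k * c ^+ (h * k.+1 + 1).
have s2 : s * s = 1.
  by rewrite -expr2 exprMn sqrr_sign mul1r exprAC c2 expr1n.
have epsS : eps%:~R = s * P ^+ h.
  have d2 : (-1) ^+ k * c * ((-1) ^+ k * c) = 1.
    by rewrite -expr2 exprMn sqrr_sign mul1r.
  rewrite detC in epsE; set e := eps%:~R in epsE *.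
  rewrite -[e]mul1r -d2 -[LHS]mulrA epsE exprMn -exprM /s addn1 exprS.
  by rewrite [(k.+1 * h)%N]mulnC [P ^+ h * _]mulrC !mulrA.
have nzP : P != 0.
  apply/eqP => P0; move: epsS; rewrite P0 expr0n gtn_eqF // mulr0.
  by case: eps1 => -> /eqP; rewrite ?intrN ?oppr_eq0 oner_eq0.
have etaP : P ^+ h = (quad_char P)%:~R by rewrite euler_criterion.
have part2 : eps = (-1) ^+ ((n - 1 - mu) * (h * k.+1 + 1)) * quad_char P.
  (* Here c = (-1)^(n-r-mu) and n-1-mu = (n-r-mu) + k; the exponents agree modulo 2 because k(k+1)
     is even. *)
  have sE : s = (-1) ^+ ((n - 1 - mu) * (h * k.+1 + 1)).
    have -> : (n - 1 - mu = n - k.+1 - mu + k)%N.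
      by rewrite -{1}(subnK r_len) addnS subn1 /= addnC -addnBA // addnC.
    rewrite /s cE -exprM -exprD -signr_odd -[RHS]signr_odd; congr (_ ^+ _).
    rewrite !(oddD, oddM) /=.
    by case: (odd k); case: (odd h); case: (odd _).
  have [e1 | e1] := quad_char_neq0 nzP; apply: (signz_inj q_odd) => //.
  - by rewrite e1 mulr1 -signr_odd; case: odd; [right|left].
  - by rewrite epsS etaP sE intrM rmorphXn /= rmorphN1.
  - by rewrite e1 mulrN1 -signr_odd; case: odd; rewrite ?opprK; [left|right].
  - by rewrite epsS etaP sE intrM rmorphXn /= rmorphN1.
split.
- split=> //; rewrite prodrXl -iotaP subn1 /=.
  have -> : (-1) ^+ k * iota c ^+ (h * k.+1 + 1) = iota s.
    by rewrite rmorphM rmorph_sign rmorphXn.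
  rewrite -rmorphXn; split=> [e1 | /fmorph_inj Ps].
    have : s * P ^+ h = 1 by rewrite -epsS e1.
    by move/(congr1 (fun x => s * x)); rewrite mulrA s2 mul1r mulr1 => ->.
  by apply: (signz_inj q_odd) => //; [left | rewrite epsS Ps s2].
- by exists P.
(* For r = n the gcd is 1, so mu = 0 and [G] agrees with [Ls] at every root of X^n - 1. *)
- move=> rn; exists P; split.
    rewrite iotaP; apply: eq_big => [j|j _]; first by rewrite rn ltn_ord.
    have : root ('X^n - 1) (omega j).
      by rewrite homega /root horner_prod (bigD1 j) //= hornerXsubC subrr mul0r.
    move/(root_dvdp hG); rewrite big_pred0 ?mulr1 => [|i]; last first.
      by rewrite ltnNge -ltnS rn ltn_ord.
    by rewrite /root hornerD hornerN subr_eq0 => /eqP.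
  rewrite part2; have -> : mu = 0%N by apply/eqP; rewrite -leqn0 (leq_trans le_mu) // rn subnn.
  congr (_ * _); rewrite -rn subn0 subn1 /= -signr_odd -[RHS]signr_odd; congr (_ ^+ _).
  by rewrite !(oddD, oddM) /=; case: (odd k); case: (odd h).
move=> m b rE lt_rn sz_ell lead_ell.
have m_gt0 : (0 < m)%N by case: m rE {sz_ell} lt_rn => // ->; rewrite muln0 subn0 ltnn.
have lt_2mn : (2 * m < n)%N by rewrite -subn_gt0 -rE.
have nE : n = (k.+1 + 2 * m)%N by rewrite rE subnK // ltnW.
have lt_mn : (m < n)%N by rewrite (leq_ltn_trans _ lt_2mn) // leq_pmull.
have lt_mnm : (m < n - m)%N by rewrite ltn_subRL addnn -mul2n.
have q1 : (1 < q)%N := finNzRing_gt1 F.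
have ell0 i : (m < i)%N -> ell`_(q ^ i) = 0.
  by move=> lt_mi; rewrite nth_default // sz_ell ltn_exp2l.
have iter0 i : iter i (@frob F E) 0 = 0 by rewrite -frobpXn frobpr0.
have Lcoef i : (i < n)%N -> (Ls`_i *+ 2)%:A
    = ell`_(q ^ i) + iter i (@frob F E) ell`_(q ^ ((n - i) %% n)).
  by rewrite hLs; apply: (qsymL_coef q_odd L_coef).
(* Since n - m > m, the companion of [ell] has no term of index m, so b is twice this
   coefficient. *)
pose am := Ls`_m.
have amE : (am *+ 2)%:A = b.
  rewrite Lcoef // modn_small ?ltn_subrL ?m_gt0 // [X in iter _ _ X]ell0 //.
  by rewrite iter0 addr0 -lead_ell lead_coefE sz_ell.
have nzam : am != 0.
  apply: contraNneq ell_neq0 => am0; rewrite -lead_coef_eq0 lead_ell -amE.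
  by rewrite am0 mul0rn scale0r.
have Lmid i : (m < i < n - m)%N -> Ls`_i = 0.
  case/andP=> lt_mi lt_inm; have lt_in := leq_trans lt_inm (leq_subr m n).
  have := Lcoef _ lt_in; rewrite modn_small ?ltn_subrL ?(leq_trans _ lt_mi) //.
  rewrite !ell0 // ?iter0 ?addr0; last by rewrite ltn_subCr.
  move/eqP; rewrite scaler_eq0 oner_eq0 orbF -mulr_natr mulf_eq0.
  by rewrite (negPf (natr2_neq0 q_odd)) orbF => /eqP.
(* This is X^m L^* reduced modulo X^n - 1. Only indices at most m or at least n-m carry nonzero
   coefficients of [Ls], so the degree is at most 2m, with [am] at both ends. *)
pose R0 := 'X^m * take_poly (n - m) Ls + drop_poly (n - m) Ls.
have R0E : 'X^m * Ls - R0 = drop_poly (n - m) Ls * ('X^n - 1).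
  rewrite -{1}(poly_take_drop (n - m) Ls) mulrDr /R0 opprD addrACA subrr add0r.
  by rewrite mulrBr mulr1 mulrCA -exprD subnKC // ltnW.
have DR0 : D %| R0.
  have -> : R0 = 'X^m * Ls - ('X^m * Ls - R0) by rewrite opprB addrCA subrr addr0.
  by rewrite R0E; apply: dvdp_sub; apply: dvdp_mull.
have R0_2m : R0`_(2 * m) = am.
  rewrite coefD coefXnM coef_take_poly coef_drop_poly mul2n -addnn ltnNge leq_addr /=.
  rewrite addnK lt_mnm [X in _ + X]nth_default ?addr0 //.
  by rewrite -addnA (subnKC (ltnW lt_mn)) (leq_trans szL) // leq_addl.
have R0_0 : R0`_0 = am.
  by rewrite coefD coefXnM m_gt0 add0r coef_drop_poly add0n palL // m_gt0.
have szR0 : (size R0 <= (2 * m).+1)%N.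
  apply/leq_sizeP => j lt_j; rewrite coefD coefXnM coef_take_poly coef_drop_poly.
  have le_mj : (m <= j)%N by rewrite (leq_trans _ (ltnW lt_j)) // leq_pmull.
  rewrite ltnNge le_mj /= [X in _ + X]nth_default ?addr0; last first.
    by rewrite (leq_trans szL) // addnC -leq_subLR (subKn (ltnW lt_mn)).
  by case: ifP => // lt_jnm; rewrite Lmid // lt_jnm andbT ltn_subRL addnn -mul2n.
have szD2 : size D = (2 * m).+1 by rewrite szD rE subKn // ltnW.
(* [D] divides [R0] and has degree n - r = 2m; comparing constant terms will then give c = 1. *)
have R0D : R0 = am *: D.
  have nzR0 : R0 != 0 by apply: contraNneq nzam => R00; rewrite -R0_0 R00 coef0.
  have : D %= R0 by rewrite -dvdp_size_eqp // eqn_leq dvdp_leq //= szD2.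
  rewrite eqp_sym => /eqpf_eq[t _ tE]; rewrite tE; congr (_ *: _).
  rewrite -R0_2m tE coefZ; move/monicP: monD; rewrite lead_coefE szD2 /= => ->.
  by rewrite mulr1.
have c1 : c = 1.
  by apply: (mulfI nzam); rewrite mulr1 -{2}R0_0 R0D coefZ.
(* Cancelling [D] modulo [D * H] shows that C^m G(C) is the scalar matrix [am], and determinants
   then give [P]. *)
have HG : H %| 'X^m * G - am%:P.
  rewrite -(dvdp_mul2l _ _ nzD) DH.
  have -> : D * ('X^m * G - am%:P) = ('X^m * Ls - R0) - 'X^m * (Ls - G * D).
    rewrite R0D !mulrBr opprB [RHS]addrC addrA subrK [D * am%:P]mulrC mul_polyC.
    by rewrite mulrCA [D * G]mulrC.
  by rewrite R0E; apply: dvdp_sub; apply: dvdp_mull.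
have detP : ((-1) ^+ k) ^+ m * P = am ^+ k.+1.
  move: HG; rewrite -(horner_modmx_eq0 monH szH) rmorphB rmorphM rmorphXn /=.
  rewrite horner_mx_X horner_mx_C subr_eq0 => /eqP/(congr1 (fun M => \det M)).
  have detX t : \det (modmx k H ^+ t) = \det (modmx k H) ^+ t.
    by elim: t => [|t IHt]; rewrite ?det1 // !exprS det_mulmx IHt.
  by rewrite det_mulmx det_scalar detX detC c1 mulr1.
have PE : P = (-1) ^+ (k * m) * am ^+ k.+1.
  by rewrite -detP -exprM mulrA -expr2 sqrr_sign mul1r.
(* The witness is b = 2 [am], so 2b = 4 [am] has the quadratic character of [am]. *)
exists (am *+ 2); split=> //.
have -> : 2%:R * (am *+ 2) = 2%:R ^+ 2 * am by rewrite -[am *+ 2]mulr_natl mulrA -expr2.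
rewrite quad_charMsq ?natr2_neq0 //; apply: (signz_inj q_odd) => //.
  have [->|->] := quad_char_neq0 nzam; rewrite ?expr1n ?mulr1 -?exprD -signr_odd.
    by case: odd; [right|left].
  by case: odd; [right|left].
rewrite epsS intrM !rmorphXn /= rmorphN1 -euler_criterion // -/q -/h.
rewrite /s c1 expr1n mulr1 PE exprMn -!exprM.
have am2 : am ^+ (2 * h) = 1 by rewrite -card_half // expf_pred_card.
(* The exponents n and r differ by 2m, and am^(2h) = 1. *)
have -> : am ^+ (h * n) = am ^+ (k.+1 * h).
  rewrite nE mulnDr exprD mulnA [(h * 2)%N]mulnC.
  by rewrite [am ^+ (2 * h * m)]exprM am2 expr1n mulr1 mulnC.
rewrite mulrA -exprD; congr (_ * _); rewrite -signr_odd -[RHS]signr_odd; congr (_ ^+ _).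
by rewrite nE subn1 /= !(oddD, oddM) /=; case: (odd k); case: (odd m); case: (odd h).
Qed.
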